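(* Let $\Psi\subset\{\mathcal{S}\to\mathbb{R}^d\}$ and $\Phi\subset\{\mathcal{S}\times\mathcal{A}\to\mathbb{R}^d\}$ be finite classes with $\|\phi(s,a)\|_2\le1$ for all $(s,a)$ and $\phi\in\Phi$, and $\int\|\mu(s)\|_2\,ds<\infty$ for all $\mu\in\Psi$. Suppose $P^\star(s'|s,a)=\mu^*(s')^\top\phi^*(s,a)$ with $\mu^*\in\Psi$, $\phi^*\in\Phi$. Suppose $\rho(s,a)=\rho(s)\pi_b(a|s)$ where $\rho(s)$ is a stationary distribution of a behavior policy $\pi_b$: $\rho(s)=\int\rho(s')\pi_b(a'|s')P^\star(s|s',a')\,d(s',a')$ for all $s$. Run CPPO with model class $\mathcal{M}=\{\mu(s')^\top\phi(s,a):\mu\in\Psi,\phi\in\Phi\}$, where the MLE is $(\hat\mu,\hat\phi)=\arg\max_{\mu\in\Psi,\phi\in\Phi}\mathbb{E}_{\mathcal{D}}[\ln\mu(s')^\top\phi(s,a)-\ln\int\mu(s'')^\top\phi(s,a)ds'']$, and threshold $\xi=c_1\ln(|\Phi||\Psi|/\delta)/n$ for a suitable universal constant $c_1$. For any comparator $\pi^*$ with $\bar C_{\pi^*,P^\star}<\infty$, $C_{d_0,P^\star}<\infty$ and $1/\min_{s,a}\pi_b(a|s)<\infty$, with probability at least $1-\delta$, $$V^{\pi^*}_{P^\star}-V^{\hat\pi}_{P^\star}\le\xi^{1/2}|\mathcal{A}|^{1/2}\left\{H\sqrt{C_{d_0,P^\star}}+H^2\sqrt{\frac{\bar C_{\p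i^*,P^\star}\,\mathrm{rank}(\Sigma_\rho)}{\min_{(s,a)}\pi_b(a|s)}}\right\}.$$
   Context: Episodic finite-horizon MDP with horizon $H$, reward $r\in[0,1]$, initial distribution $d_0$, true transition $P^\star$ (low-rank, with features $\mu^*,\phi^*$ unknown to the learner). $V^\pi_P$ is the expected cumulative $H$-step reward of Markov policy $\pi$ under $P$; $d^\pi_P=\frac1H\sum_{t=0}^{H-1}d^\pi_{P,t}$ with $d^\pi_{P,t}$ the law of $(s_t,a_t)$. $\Pi$ is the class of all Markov policies. Data $\mathcal{D}=\{(s_i,a_i,s_i')\}_{i=1}^n$ i.i.d., $(s_i,a_i)\sim\rho$, $s_i'\sim P^\star(\cdot|s_i,a_i)$; $\mathbb{E}_{\mathcal{D}}$ is the empirical average. CPPO: with $\hat P_{\mathrm{MLE}}$ the MLE model, $\mathcal{M}_{\mathcal{D}}=\{P\in\mathcal{M}:\mathbb{E}_{\mathcal{D}}\|P(\cdot|s,a)-\hat P_{\mathrm{MLE}}(\cdot|s,a)\|_1^2\le\xi\}$ and $\hat\pi=\arg\max_{\pi\in\Pi}\min_{P\in\mathcal{M}_{\mathcal{D}}}V^\pi_P$. $\Sigma_{\pi^*}=\mathbb{E}_{d^{\pi^*}_{P^\star}}[\phi^*\phi^{*\top}]$, $\Sigma_\rho=\mathbb{E}_\rho[\phi^*\phi^{*\top}]$, $\bar C_{\pi^*,P^\star}=\sup_{x\in\mathbb{R}^d}\frac{x^\top\Sigma_{\pi^*}x}{x^\top\Sigma_\rho x}$. $C_{d_0,P^\star}=\sup_{P\in\mathcal{M}}\frac{\mathbb{E}_{s\sim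 d_0,a\sim U(\mathcal{A})}\|P(\cdot|s,a)-P^\star(\cdot|s,a)\|_1^2}{\mathbb{E}_{(s,a)\sim\rho}\|P(\cdot|s,a)-P^\star(\cdot|s,a)\|_1^2}$, with $U(\mathcal{A})$ the uniform distribution on $\mathcal{A}$.
   Formalization: Every member μ(s')ᵀφ(s,a) of the model class is assumed to be a transition density (nonnegative with integral 1), which is needed for the value of a policy under P to be defined; the normalising term in the MLE objective is then zero. *)

(* Defs.v *)
From HB Require Import structures.
From mathcomp Require Import all_boot all_order all_algebra.
From mathcomp Require Import all_classical all_reals all_analysis.
Set Implicit Arguments. Unset Strict Implicit. Unset Printing Implicit Defensive.
Import Order.TTheory GRing.Theory Num.Theory.
Import numFieldNormedType.Exports.
Local Open Scope classical_set_scope.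
Local Open Scope ring_scope.

Section LowRankDefs.
Context {R : realType} {dS : measure_display} {S : measurableType dS} {A : finType}.

Definition dotv (d : nat) (x y : 'I_d -> R) : R := \sum_(i < d) x i * y i.
Definition norm2 (d : nat) (x : 'I_d -> R) : R := Num.sqrt (\sum_(i < d) x i ^+ 2).

(* A transition density w.r.t. base measure lam : P s a s' = P(s'|s,a). *)
Definition tdens := S -> A -> S -> R.

Definition markov_policy (pi : nat -> S -> A -> R) : Prop :=
  [/\ forall t s a, 0 <= pi t s a,
      forall t s, \sum_(a : A) pi t s a = 1 &
      forall t a, measurable_fun setT (fun s => pi t s a)].

(* One step of the dynamics acting on test functions:
   (step t f)(s) = E[f(s_{t+1}) | s_t = s]. *)
Definition step (lam : {measure set S -> \bar R}) (P : tdens)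
  (pi : nat -> S -> A -> R) (t : nat) (f : S -> R) : S -> R :=
  fun s => \sum_(a : A) pi t s a * Rintegral lam setT (fun s' => P s a s' * f s').

(* state_exp t f = E[f(s_t)] where s_0 ~ d0, a_t ~ pi_t(.|s_t), s_{t+1} ~ P(.|s_t,a_t). *)
Fixpoint state_exp (lam : {measure set S -> \bar R}) (d0 : probability S R)
  (P : tdens) (pi : nat -> S -> A -> R) (t : nat) (f : S -> R) : R :=
  match t with
  | O => Rintegral d0 setT f
  | t'.+1 => state_exp lam d0 P pi t' (step lam P pi t' f)
  end.

Definition occ_exp lam d0 (P : tdens) pi (t : nat) (g : S -> A -> R) : R :=
  state_exp lam d0 P pi t (fun s => \sum_(a : A) pi t s a * g s a).

Definition value lam d0 (H : nat) (r : S -> A -> R) (P : tdens) pi : R :=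
  \sum_(t < H) occ_exp lam d0 P pi t r.

Definition Sigma_pi lam d0 (H : nat) (d : nat) (phi : S -> A -> 'I_d -> R)
  (P : tdens) pi : 'M[R]_d :=
  \matrix_(i, j) ((H%:R)^-1 * \sum_(t < H) occ_exp lam d0 P pi t (fun s a => phi s a i * phi s a j)).

Definition rho_exp (lam : {measure set S -> \bar R}) (rho : S -> R) (pib : S -> A -> R)
  (g : S -> A -> R) : R :=
  Rintegral lam setT (fun s => rho s * \sum_(a : A) pib s a * g s a).

Definition Sigma_rho lam rho pib (d : nat) (phi : S -> A -> 'I_d -> R) : 'M[R]_d :=
  \matrix_(i, j) rho_exp lam rho pib (fun s a => phi s a i * phi s a j).

Definition eratio (x y : R) : \bar R :=
  if 0 < y then (x / y)%:E else if x == 0 then 0%E else +oo%E.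

Definition quadf (d : nat) (M : 'M[R]_d) (x : 'cV[R]_d) : R := (x^T *m M *m x) 0 0.

Definition Cbar (d : nat) (Spi Srho : 'M[R]_d) : \bar R :=
  ereal_sup [set eratio (quadf Spi x) (quadf Srho x) | x in [set: 'cV[R]_d]].

Definition l1dist (lam : {measure set S -> \bar R}) (P Q : tdens) (s : S) (a : A) : R :=
  Rintegral lam setT (fun s' => `|P s a s' - Q s a s'|).

(* C_{d0,P*} = sup_{P in M} E_{d0 x U(A)} ||P-P*||_1^2 / E_rho ||P-P*||_1^2 ;
   the model class is given as the image of a finite index type. *)
Definition Cd0 (I : Type) (model : I -> tdens) lam (d0 : probability S R) rho pib
  (Pstar : tdens) : \bar R :=
  ereal_sup [set eratio
      (Rintegral d0 setT (fun s => (#|A|%:R)^-1 * \sum_(a : A) l1dist lam (model m) Pstar s a ^+ 2))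
      (rho_exp lam rho pib (fun s a => l1dist lam (model m) Pstar s a ^+ 2))
    | m in [set: I]].

(* min_{s,a} pi_b(a|s) (an infimum, the state space being arbitrary) *)
Definition pib_min (pib : S -> A -> R) : R := inf [set x | exists s a, x = pib s a].

Definition elog (v : R) : \bar R := if 0 < v then (ln v)%:E else -oo%E.

End LowRankDefs.

(* Main.v *)
(* Simulating the dynamics one step at a time bounds the value gap between the true model
   P* and a model P by sum_t (H-t-1)/2 E_t |P - P*|_1, the expectations being under P* and the
   comparator.  The term t = 0 is controlled by C_{d0,P*}.  For t >= 1, conditioning on
   (s_{t-1}, a_{t-1}) makes the term linear in phi*; expanding along a Sigma_rho-orthonormal
   family, which has at most rank Sigma_rho members, turns it into a trace controlled by
   Cbar, and stationarity of rho converts the resulting Sigma_rho-norms into E_rho |P - P*|_1^2.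

   Put L = ln (|Phi| |Psi| / delta).  For every model P both
   prod_i sqrt (P / P* ) exp (l^2 / 8) and prod_i exp (- l^2 / 4) exp (E_rho l^2 / 8), with
   l(s, a) = |P - P*|_1, have expectation at most 1, so by Markov's inequality and a union
   bound none exceeds exp (2 L).  For the MLE the first gives sum_i l^2 <= 16 L, hence P* lies
   in the version space; the second and the triangle inequality then give E_rho l^2 <= 4 xi on
   the whole version space, with c_1 = 112, and pessimism transfers the value gap bound from
   the comparator to the learned policy. *)

Require Import Defs.
From HB Require Import structures.
From mathcomp Require Import all_boot all_order all_algebra.
From mathcomp Require Import all_classical all_reals all_analysis.
From mathcomp Require Import measurable_realfun ring lra.
Import Order.TTheory GRing.Theory Num.Theory.
Import numFieldNormedType.Exports.
Local Open Scope classical_set_scope.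
Local Open Scope ring_scope.

(** Two obstacles shape the argument. The base measure [lam] is arbitrary, possibly not
    sigma-finite, so integrals over states cannot be exchanged freely. For the dynamics the low-rank
    form replaces every exchange by a finite sum over feature coordinates. Where Tonelli is
    unavoidable (measurability of the L1 distance, joint law of a sample) the densities are divided
    by an integrable dominating function and [lam] is replaced by a finite measure. The second
    obstacle is that independence is given only on measurable rectangles and a finite, unstructured
    action set; it is extended to products of functions one coordinate at a time. The two statistics
    are chosen for having mean at most one: the tail bound then has a single exponential form, and
    the errors decay like [L / n] with no variance term. [Sigma_rho] may be singular, so no inverse
    of it is formed: directions it does not see are also unseen by the comparator, because [Cbar] is
    finite. *)

(** * Finite measures given by a density *)

Section FiniteDensity.
Set Implicit Arguments. Unset Strict Implicit.
Context d (T : measurableType d) (R : realType).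
Variables (mu : {measure set T -> \bar R}) (f : T -> R).
Hypotheses (f0 : forall x, 0 <= f x) (mf : measurable_fun setT f)
  (intf : (\int[mu]_x (f x)%:E < +oo)%E).

(** The proofs are arguments of the definition so that the measure and finite-measure structures can
    be inferred from the term itself. *)
Definition dens_measure of (forall x, 0 <= f x) & measurable_fun setT f
  & (\int[mu]_x (f x)%:E < +oo)%E : set T -> \bar R :=
  fun A => (\int[mu]_(x in A) (f x)%:E)%E.
Let nu := dens_measure f0 mf intf.

Local Lemma dens_measure0 : nu set0 = 0%E.
Proof. by rewrite /nu /dens_measure integral_set0. Qed.

Local Lemma dens_measure_ge0 A : (0 <= nu A)%E.
Proof. by apply: integral_ge0 => x _; rewrite lee_fin. Qed.

Local Lemma dens_measure_sigma_additive : semi_sigma_additive nu.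
Proof.
move=> F mF tF mUF; rewrite /nu /dens_measure ge0_integral_bigcup//.
- by apply: is_cvg_ereal_nneg_natsum => n _; exact: dens_measure_ge0.
- by apply/measurable_EFinP; exact: measurable_funTS.
- by move=> x _; rewrite lee_fin.
Qed.

HB.instance Definition _ := isMeasure.Build _ _ _ nu
  dens_measure0 dens_measure_ge0 dens_measure_sigma_additive.

Local Lemma dens_measure_fin : fin_num_fun nu.
Proof.
move=> A mA; rewrite ge0_fin_numE ?dens_measure_ge0//.
apply: le_lt_trans intf; apply: ge0_subset_integral => //.
- exact/measurable_EFinP.
- by move=> x _; rewrite lee_fin.
Qed.

HB.instance Definition _ := Measure_isFinite.Build _ _ _ nu dens_measure_fin.

Import HBNNSimple.

(** Monotone convergence along the same simple functions on both sides reduces this to indicators,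
    where it is the definition of [nu]. The argument is valid over an arbitrary base measure. *)
Lemma integral_dens_measure (h : T -> \bar R) : measurable_fun setT h ->
  (forall x, 0 <= h x)%E ->
  (\int[nu]_x h x = \int[mu]_x (h x * (f x)%:E))%E.
Proof.
move=> mh h0; pose g := nnsfun_approx measurableT mh.
have gh x : ((EFin \o g n) x @[n --> \oo] --> h x)%E.
  by apply: cvg_nnsfun_approx.
have -> : (\int[nu]_x h x = lim (\int[nu]_x (EFin \o g n) x @[n --> \oo]))%E.
  under eq_integral => x _ do rewrite -(cvg_lim _ (gh x))//.
  apply: monotone_convergence => //.
  - by move=> n; exact/measurable_EFinP.
  - by move=> n x _; rewrite lee_fin.
  - by move=> x _ a b ab; rewrite lee_fin; exact/lefP/nd_nnsfun_approx.
have -> : (\int[mu]_x (h x * (f x)%:E) =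
    lim (\int[mu]_x ((g n x)%:E * (f x)%:E) @[n --> \oo]))%E.
  have ghf x : ((g n x)%:E * (f x)%:E @[n --> \oo] --> h x * (f x)%:E)%E.
    exact: (@cvgeZr _ _ _ _ _ (f x)%:E isT (gh x)).
  under eq_integral => x _ do rewrite -(cvg_lim _ (ghf x))//.
  apply: monotone_convergence => //.
  - by move=> n; apply/measurable_EFinP; exact: measurable_funM.
  - by move=> n x _; rewrite mule_ge0 ?lee_fin.
  - move=> x _ a b ab; rewrite -!EFinM lee_fin ler_wpM2r//.
    exact/lefP/nd_nnsfun_approx.
suff E n : (\int[nu]_x (g n x)%:E = \int[mu]_x ((g n x)%:E * (f x)%:E))%E.
  by under eq_fun do rewrite E.
under [LHS]eq_integral => x _ do rewrite (fimfunE (g n)) -fsumEFin//.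
rewrite ge0_integral_fsum//; last 2 first.
  - by move=> y; apply/measurable_EFinP; exact: measurable_funM.
  - by move=> y x _; exact: nnfun_muleindic_ge0.
have indge0 y x : (0 <= (y * \1_(g n @^-1` [set y]) x)%:E * (f x)%:E)%E.
  by rewrite mule_ge0 ?lee_fin//; exact: nnfun_muleindic_ge0.
under [RHS]eq_integral => x _.
  rewrite fimfunE -fsumEFin// ge0_mule_fsuml//; last first.
    by move=> y; exact: nnfun_muleindic_ge0.
  over.
rewrite ge0_integral_fsum//; last first.
  move=> y; apply: emeasurable_funM; last exact/measurable_EFinP.
  by apply/measurable_EFinP; exact: measurable_funM.
apply: eq_fsbigr => y; rewrite inE => -[x0 _ yE].
have y0 : 0 <= y by rewrite -yE.
have mA : measurable (g n @^-1` [set y]) by exact: measurable_sfunP.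
under eq_integral do rewrite EFinM.
rewrite ge0_integralZl_EFin//; last exact/measurable_EFinP.
rewrite integral_indic// setIT.
under [RHS]eq_integral do rewrite EFinM -muleA.
rewrite ge0_integralZl_EFin//; last 2 first.
  - by move=> x _; rewrite mule_ge0 ?lee_fin.
  - by apply: emeasurable_funM; exact/measurable_EFinP.
congr (_ * _)%E; rewrite /nu /dens_measure /= [LHS]integral_mkcond.
apply: eq_integral => x _; rewrite patchE indicE; case: ifP => _ /=.
  by rewrite mul1e.
by rewrite mul0e.
Qed.

End FiniteDensity.

(** * Positive normalised linear functionals on an algebra of functions *)

Section FunctionAlgebra.
Set Implicit Arguments. Unset Strict Implicit.
Context {R : realType} {U : Type}.
Implicit Types (B : (U -> R) -> Prop) (f g : U -> R) (L : (U -> R) -> R).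

Record function_algebra B : Prop := FunctionAlgebra {
  alg_cst : forall c, B (fun=> c);
  alg_add : forall f g, B f -> B g -> B (fun x => f x + g x);
  alg_mul : forall f g, B f -> B g -> B (fun x => f x * g x) }.

(** The law of the state at time [t] exists only as an iterated integral of test functions, not as a
    measure. These four properties are all that the inequalities below use, so one interface serves
    kernels, occupancies and [rho]. *)
Record expectation_on B L : Prop := ExpectationOn {
  expect_alg : function_algebra B;
  expectD : forall f g, B f -> B g -> L (fun x => f x + g x) = L f + L g;
  expectZ : forall c f, B f -> L (fun x => c * f x) = c * L f;
  expect_ge0 : forall f, B f -> (forall x, 0 <= f x) -> 0 <= L f;
  expect1 : L (fun=> 1) = 1 }.

Section Closure.
Variables (B : (U -> R) -> Prop) (HB : function_algebra B).

Lemma alg_scale c f : B f -> B (fun x => c * f x).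
Proof. by move=> bf; apply: (alg_mul HB) => //; exact: alg_cst. Qed.

Lemma alg_sub f g : B f -> B g -> B (fun x => f x - g x).
Proof.
move=> bf /(alg_scale (-1)) bg; have := alg_add HB bf bg.
by under eq_fun do rewrite mulN1r.
Qed.

Lemma alg_sqr f : B f -> B (fun x => f x ^+ 2).
Proof. by move=> bf; have := alg_mul HB bf bf. Qed.

Lemma alg_sum (I : Type) (s : seq I) (h : I -> U -> R) :
  (forall i, B (h i)) -> B (fun x => \sum_(i <- s) h i x).
Proof.
move=> bh; elim: s => [|i s IH].
  by under eq_fun do rewrite big_nil; exact: alg_cst.
by under eq_fun do rewrite big_cons; exact: (alg_add HB).
Qed.

End Closure.

Section Expectation.
Variables (B : (U -> R) -> Prop) (L : (U -> R) -> R) (EL : expectation_on B L).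
Let HB := expect_alg EL.

Lemma expect_cst c : L (fun=> c) = c.
Proof.
have := expectZ EL c (alg_cst HB 1).
by under eq_fun do rewrite mulr1; rewrite (expect1 EL) mulr1.
Qed.

Lemma expectB f g : B f -> B g -> L (fun x => f x - g x) = L f - L g.
Proof.
move=> bf bg; have := expectD EL bf (alg_scale HB (-1) bg).
by under eq_fun do rewrite mulN1r; rewrite (expectZ EL)// mulN1r.
Qed.

Lemma expect_le f g : B f -> B g -> (forall x, f x <= g x) -> L f <= L g.
Proof.
move=> bf bg fg; rewrite -subr_ge0 -expectB//.
by apply: (expect_ge0 EL); [exact: alg_sub|move=> x; rewrite subr_ge0].
Qed.

Lemma expect_sum (I : Type) (s : seq I) (h : I -> U -> R) :
  (forall i, B (h i)) ->
  L (fun x => \sum_(i <- s) h i x) = \sum_(i <- s) L (h i).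
Proof.
move=> bh; elim: s => [|i s IH].
  by under eq_fun do rewrite big_nil; rewrite big_nil expect_cst.
under eq_fun do rewrite big_cons.
by rewrite (expectD EL)// ?IH ?big_cons//; exact: alg_sum.
Qed.

(** Nonnegativity of the variance, obtained by expanding the expectation of [(f - c)^2] at
    [c = L f]. *)
Lemma expect_sqr_le f : B f -> L f ^+ 2 <= L (fun x => f x ^+ 2).
Proof.
move=> bf; set c := L f.
have bf2 := alg_sqr HB bf; have bcf := alg_scale HB (2 * c) bf.
have : 0 <= L (fun x => (f x ^+ 2 - 2 * c * f x) + c ^+ 2).
  apply: (expect_ge0 EL); last by move=> x; have := sqr_ge0 (f x - c); nra.
  by apply: (alg_add HB); [exact: alg_sub|exact: alg_cst].
rewrite (expectD EL); [|exact: alg_sub|exact: alg_cst].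
by rewrite expect_cst expectB// (expectZ EL)// -/c; nra.
Qed.

End Expectation.
End FunctionAlgebra.

(** * Bounded measurable functions and the expectations acting on them *)

Section BoundedMeasurable.
Set Implicit Arguments. Unset Strict Implicit.
Context {R : realType} {d : measure_display} {T : measurableType d}.

(** [Rintegral] is total but linear only on integrable functions. Boundedness guarantees
    integrability against every probability density and survives products and transition kernels. *)
Definition bmeas (f : T -> R) : Prop :=
  measurable_fun setT f /\ exists C, forall x, `|f x| <= C.

Lemma bmeas_algebra : function_algebra bmeas.
Proof.
split.
- by move=> c; split; [exact: measurable_cst|exists `|c|].
- move=> f g [mf [C Cf]] [mg [D Dg]]; split; first exact: measurable_funD.
  by exists (C + D) => x; rewrite (le_trans (ler_normD _ _))// lerD.
- move=> f g [mf [C Cf]] [mg [D Dg]]; split; first exact: measurable_funM.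
  by exists (C * D) => x; rewrite normrM ler_pM.
Qed.

Lemma integrableM_bmeas (m : {measure set T -> \bar R}) (g f : T -> R) :
  m.-integrable setT (EFin \o g) -> bmeas f ->
  m.-integrable setT (EFin \o (fun x => g x * f x)).
Proof.
move=> ig [mf [C Cf]].
have mg : measurable_fun setT g by apply/measurable_EFinP; case/integrableP : ig.
have := integrableZl measurableT C ig; apply: le_integrable => //.
  by apply/measurable_EFinP; exact: measurable_funM.
move=> x _ /=; rewrite lee_fin !normrM mulrC ler_wpM2r//.
by rewrite (le_trans (Cf x))// ler_norm.
Qed.

End BoundedMeasurable.

Section ExpectationInstances.
Set Implicit Arguments. Unset Strict Implicit.
Context {R : realType} {d : measure_display} {T : measurableType d}.

Lemma expectation_density (m : {measure set T -> \bar R}) (p : T -> R) :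
  (forall x, 0 <= p x) -> measurable_fun setT p ->
  (\int[m]_x (p x)%:E = 1)%E ->
  expectation_on bmeas (fun f => Rintegral m setT (fun x => p x * f x)).
Proof.
move=> p0 mp p1.
have ip : m.-integrable setT (EFin \o p).
  apply/integrableP; split; first exact/measurable_EFinP.
  under eq_integral do rewrite /= ger0_norm//.
  by rewrite p1 ltry.
split.
- exact: bmeas_algebra.
- move=> f g bf bg; under eq_Rintegral do rewrite mulrDr.
  by rewrite RintegralD//; exact: integrableM_bmeas.
- move=> c f bf; under eq_Rintegral do rewrite mulrCA.
  by rewrite RintegralZl//; exact: integrableM_bmeas.
- by move=> f bf f0; apply: Rintegral_ge0 => x _; rewrite mulr_ge0.
- by under eq_Rintegral do rewrite mulr1; rewrite /Rintegral p1.
Qed.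

Lemma expectation_probability (m : probability T R) :
  expectation_on bmeas (fun f => Rintegral m setT f).
Proof.
have /= := @expectation_density m (fun=> 1).
rewrite (_ : (fun f => Rintegral m setT (fun x => 1 * f x)) =
             (fun f => Rintegral m setT f)).
  apply=> //; rewrite integral_cst//= mul1e; exact: probability_setT.
by apply/funext => f; under eq_Rintegral do rewrite mul1r.
Qed.

End ExpectationInstances.

(** * Jensen and Cauchy-Schwarz for finite sums *)

Section FiniteAverages.
Set Implicit Arguments. Unset Strict Implicit.
Context {R : realType} {A : finType}.

Lemma sqr_wsum_le (p x : A -> R) : (forall a, 0 <= p a) ->
  \sum_a p a = 1 -> (\sum_a p a * x a) ^+ 2 <= \sum_a p a * x a ^+ 2.
Proof.
move=> p0 p1; set c := \sum_a p a * x a.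
have : 0 <= \sum_a p a * (x a - c) ^+ 2.
  by apply: sumr_ge0 => a _; rewrite mulr_ge0// sqr_ge0.
have E a : p a * (x a - c) ^+ 2 =
    p a * x a ^+ 2 + (- 2 * c * (p a * x a) + c ^+ 2 * p a) by ring.
under eq_bigr do rewrite E.
rewrite !big_split/= -!mulr_sumr p1 -/c; nra.
Qed.

Lemma sqr_dotv_le (d : nat) (v x : 'I_d -> R) :
  (dotv v x) ^+ 2 <= (\sum_i v i ^+ 2) * (\sum_i x i ^+ 2).
Proof.
rewrite /dotv; set V := \sum_i v i ^+ 2; set X := \sum_i x i ^+ 2.
set D := \sum_i v i * x i.
have V0 : 0 <= V by apply: sumr_ge0 => i _; exact: sqr_ge0.
have X0 : 0 <= X by apply: sumr_ge0 => i _; exact: sqr_ge0.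
(* [V] times the Cauchy-Schwarz defect is a sum of squares; [V = 0] is treated apart because [V] is
   then cancelled. *)
have key : 0 <= V * (V * X - D ^+ 2).
  have -> : V * (V * X - D ^+ 2) = \sum_i (V * x i - D * v i) ^+ 2.
    have E i : (V * x i - D * v i) ^+ 2 =
      V ^+ 2 * x i ^+ 2 + (- 2 * V * D * (v i * x i) + D ^+ 2 * v i ^+ 2) by ring.
    under [RHS]eq_bigr do rewrite E.
    by rewrite !big_split/= -!mulr_sumr -/V -/X -/D; ring.
  by apply: sumr_ge0 => i _; exact: sqr_ge0.
have [V0'|Vn] := eqVneq V 0.
  have v0 i : v i = 0.
    have /psumr_eq0P : \sum_i v i ^+ 2 = 0 by [].
    by move=> /(_ (fun i _ => sqr_ge0 _) i isT)/eqP; rewrite sqrf_eq0 => /eqP.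
  rewrite /D big1 ?expr0n ?V0' ?mul0r// => i _; by rewrite v0 mul0r.
by rewrite -subr_ge0; rewrite pmulr_rge0// in key; rewrite lt_def Vn.
Qed.

End FiniteAverages.

(** * Markov dynamics under a policy and the simulation identity *)

Section Dynamics.
Set Implicit Arguments. Unset Strict Implicit.
Context {R : realType} {dS : measure_display} {S : measurableType dS} {A : finType}.
Variables (lam : {measure set S -> \bar R}) (d0 : probability S R).
Local Notation tdens := (@tdens R dS S A).

Record transition_kernel (P : tdens) : Prop := TransitionKernel {
  kernel_expect : forall s a, expectation_on bmeas
    (fun f => Rintegral lam setT (fun s' => P s a s' * f s'));
  kernel_bmeas : forall f a, bmeas f ->
    bmeas (fun s => Rintegral lam setT (fun s' => P s a s' * f s')) }.

Variables (pi : nat -> S -> A -> R) (mpi : markov_policy pi).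

Lemma policy_bmeas t a : bmeas (fun s => pi t s a).
Proof.
case: mpi => pi0 pi1 mpi'; split => //; exists 1 => s.
rewrite ger0_norm// -(pi1 t s) (bigD1 a)//= lerDl.
by apply: sumr_ge0.
Qed.

Lemma policy_avg_bmeas t (g : S -> A -> R) : (forall a, bmeas (g^~ a)) ->
  bmeas (fun s => \sum_a pi t s a * g s a).
Proof.
move=> bg; apply: (alg_sum bmeas_algebra) => a.
by apply: (alg_mul bmeas_algebra) => //; exact: policy_bmeas.
Qed.

Lemma step_bmeas P t f : transition_kernel P -> bmeas f ->
  bmeas (step lam P pi t f).
Proof.
by move=> kP bf; apply: policy_avg_bmeas => a; exact: kernel_bmeas.
Qed.

Lemma step_expect P t s : transition_kernel P ->
  expectation_on bmeas (fun f => step lam P pi t f s).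
Proof.
case: mpi => pi0 pi1 mpi' kP; split; rewrite /step.
- exact: bmeas_algebra.
- move=> f g bf bg; rewrite -big_split; apply: eq_bigr => a _.
  by rewrite (expectD (kernel_expect kP s a))// mulrDr.
- move=> c f bf; rewrite mulr_sumr; apply: eq_bigr => a _.
  by rewrite (expectZ (kernel_expect kP s a))// mulrCA.
- move=> f bf f0; apply: sumr_ge0 => a _; rewrite mulr_ge0//.
  exact: (expect_ge0 (kernel_expect kP s a)).
- under eq_bigr => a _ do rewrite (expect1 (kernel_expect kP s a)) mulr1.
  exact: pi1.
Qed.

Lemma state_expect P t : transition_kernel P ->
  expectation_on bmeas (state_exp lam d0 P pi t).
Proof.
move=> kP; elim: t => [|t IH] /=; first exact: expectation_probability.
split.
- exact: bmeas_algebra.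
- move=> f g bf bg; rewrite -(expectD IH); [|exact: step_bmeas..].
  by congr state_exp; apply/funext => s; exact: (expectD (step_expect t s kP)).
- move=> c f bf; rewrite -(expectZ IH); [|exact: step_bmeas..].
  by congr state_exp; apply/funext => s; exact: (expectZ (step_expect t s kP)).
- move=> f bf f0; apply: (expect_ge0 IH); first exact: step_bmeas.
  by move=> s; exact: (expect_ge0 (step_expect t s kP)).
- rewrite -[RHS](expect1 IH).
  by congr state_exp; apply/funext => s; exact: (expect1 (step_expect t s kP)).
Qed.

Section Simulation.
Variable g : nat -> S -> R.
Hypotheses (bg : forall t, bmeas (g t)) (g01 : forall t s, 0 <= g t s <= 1).

(** The value-to-go at time [t] with [k] rewards still to collect; counting the remaining steps
    makes the backward recursion structural. *)
Fixpoint vfun (P : tdens) (t k : nat) : S -> R :=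
  if k is k'.+1 then fun s => g t s + step lam P pi t (vfun P t.+1 k') s
  else fun=> 0.

Lemma vfun_bmeas P t k : transition_kernel P -> bmeas (vfun P t k).
Proof.
move=> kP; elim: k t => [|k IH] t /=; first exact: (alg_cst bmeas_algebra).
by apply: (alg_add bmeas_algebra) => //; exact: step_bmeas.
Qed.

Lemma vfun_bounds P t k s : transition_kernel P -> 0 <= vfun P t k s <= k%:R.
Proof.
move=> kP; elim: k t s => [|k IH] t s /=; first by rewrite lexx.
have bv := vfun_bmeas t.+1 k kP; have E := step_expect t s kP.
have s0 : 0 <= step lam P pi t (vfun P t.+1 k) s.
  by apply: (expect_ge0 E) => // x; case/andP: (IH t.+1 x).
have s1 : step lam P pi t (vfun P t.+1 k) s <= k%:R.
  rewrite -(expect_cst E k%:R); apply: (expect_le E) => //; first exact: (alg_cst bmeas_algebra).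
  by move=> x; case/andP: (IH t.+1 x).
by case/andP: (g01 t s) => ? ?; rewrite addr_ge0//= -natr1 addrC lerD.
Qed.

Lemma state_exp_vfun P t k : transition_kernel P ->
  state_exp lam d0 P pi t (vfun P t k) =
  \sum_(i < k) state_exp lam d0 P pi (t + i) (g (t + i)).
Proof.
move=> kP; elim: k t => [|k IH] t /=.
  by rewrite big_ord0 (expect_cst (state_expect t kP)).
rewrite (expectD (state_expect t kP))//; last by apply: step_bmeas => //; exact: vfun_bmeas.
have := IH t.+1; rewrite /= => ->; rewrite big_ord_recl/= addn0.
by congr (_ + _); apply: eq_bigr => i _; rewrite /bump /= add1n -addSnnS.
Qed.

Lemma simulation P Q H : transition_kernel P -> transition_kernel Q ->
  \sum_(t < H) state_exp lam d0 P pi t (g t) -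
  \sum_(t < H) state_exp lam d0 Q pi t (g t) =
  \sum_(t < H) state_exp lam d0 P pi t (fun s =>
     step lam P pi t (vfun Q t.+1 (H - t.+1)) s
   - step lam Q pi t (vfun Q t.+1 (H - t.+1)) s).
Proof.
move=> kP kQ.
(* The hybrid process follows [P] for [k] steps and [Q] afterwards: its value is that of [Q] at
   [k = 0] and that of [P] at [k = H], and each increment is one summand on the right. *)
have tel k : (k <= H)%N ->
    \sum_(t < k) state_exp lam d0 P pi t (g t)
    + state_exp lam d0 P pi k (vfun Q k (H - k))
    - \sum_(t < H) state_exp lam d0 Q pi t (g t) =
    \sum_(t < k) state_exp lam d0 P pi t (fun s =>
       step lam P pi t (vfun Q t.+1 (H - t.+1)) s
     - step lam Q pi t (vfun Q t.+1 (H - t.+1)) s).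
  elim: k => [_|k IH kH].
    rewrite !big_ord0 add0r subn0 /= -/(state_exp lam d0 Q pi 0 _).
    by rewrite state_exp_vfun// subrr.
  rewrite !big_ord_recr/= -IH ?(ltnW kH)//.
  have E := state_expect k kP.
  have bv := vfun_bmeas k.+1 (H - k.+1) kQ.
  have bP := step_bmeas k kP bv; have bQ := step_bmeas k kQ bv.
  rewrite (expectB E)// -(subnSK kH) /= (expectD E)//; ring.
have := tel H (leqnn H); rewrite subnn /= (expect_cst (state_expect H kP)) addr0.
by move=> ->.
Qed.

End Simulation.
End Dynamics.

(** * Orthonormal families for a positive semidefinite form *)

Section OrthonormalFamily.
Set Implicit Arguments. Unset Strict Implicit.
Context {R : realType} {d : nat}.

(* A family of maximal size; [quadf M u > 0] would let us append [u / sqrt (quadf M u)]. *)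
Lemma maximal_orthonormal_family (M : 'M[R]_d) :
  M^T = M -> (forall x, 0 <= quadf M x) ->
  exists r (X : 'M[R]_(d, r)), [/\ (r <= \rank M)%N, X^T *m M *m X = 1%:M &
    forall u : 'cV[R]_d, X^T *m M *m u = 0 -> quadf M u = 0].
Proof.
move=> symM psdM.
pose P r := `[< exists X : 'M[R]_(d, r), X^T *m M *m X = 1%:M >].
have P0 : exists r, P r.
  by exists 0%N; apply/asboolP; exists 0; apply/matrixP => -[].
have Prank r : P r -> (r <= \rank M)%N.
  move=> /asboolP[X XMX].
  rewrite -(mxrank1 R r) -XMX (leq_trans (mxrankM_maxl _ _))//.
  exact: mxrankM_maxr.
case: (ex_maxnP P0 Prank) => r /asboolP[X XMX] rmax.
exists r, X; split => //; first by apply: Prank; apply/asboolP; exists X.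
move=> u Xu; apply/eqP; rewrite eq_le psdM andbT leNgt; apply/negP => q0.
pose c := Num.sqrt (quadf M u); pose v := c^-1 *: u.
have c0 : c != 0 by rewrite lt0r_neq0// sqrtr_gt0.
have Xv : X^T *m M *m v = 0 by rewrite -scalemxAr Xu scaler0.
have vX : v^T *m M *m X = 0.
  by apply: trmx_inj; rewrite trmx0 !trmx_mul trmxK symM mulmxA.
have vv : v^T *m M *m v = 1%:M.
  have -> : v^T *m M *m v = (c^-1 * c^-1) *: (u^T *m M *m u).
    rewrite /v -scalemxAr [(_ *: _)^T]linearZ /=.
    by rewrite -!scalemxAl scalerA.
  apply/matrixP => i j; rewrite !ord1 mxE -/(quadf M u) !mxE.
  by rewrite -invfM -expr2 sqr_sqrtr ?ltW// eqxx mulVf// lt0r_neq0.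
suff /rmax : P (r + 1)%N by rewrite addn1 ltnn.
apply/asboolP; exists (row_mx X v).
by rewrite tr_row_mx mul_col_mx mul_col_row XMX Xv vX vv -scalar_mx_block.
Qed.

(** Pythagoras for the semi-inner product of [M]: [X *m v] is the projection of [w] onto the family
    and [u] the residual. Projecting through the family avoids inverting [M]. *)
Lemma quadf_orthonormal (M : 'M[R]_d) (r : nat) (X : 'M[R]_(d, r)) (w : 'cV[R]_d) :
  M^T = M -> X^T *m M *m X = 1%:M ->
  let v := X^T *m M *m w in let u := w - X *m v in
  X^T *m M *m u = 0 /\ quadf M w = \sum_k v k 0 ^+ 2 + quadf M u.
Proof.
move=> symM XMX v u.
have Xu : X^T *m M *m u = 0 by rewrite mulmxBr mulmxA XMX mul1mx subrr.
have uX : u^T *m M *m X = 0.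
  by apply: trmx_inj; rewrite trmx0 !trmx_mul trmxK symM mulmxA.
split=> //; have -> : w = X *m v + u by rewrite addrC subrK.
clearbody u v.
rewrite {1}/quadf [(_ + _)^T]linearD/= trmx_mul !mulmxDl !mulmxDr.
rewrite (_ : u^T *m M *m (X *m v) = 0); last by rewrite mulmxA uX mul0mx.
rewrite (_ : v^T *m X^T *m M *m u = 0); last first.
  by rewrite -!mulmxA (mulmxA X^T) Xu mulmx0.
rewrite (_ : v^T *m X^T *m M *m (X *m v) = v^T *m v); last first.
  by rewrite !mulmxA -(mulmxA _ X^T) -(mulmxA _ (X^T *m M)) XMX mulmx1.
rewrite addr0 add0r mxE; congr (_ + _); rewrite mxE.
by apply: eq_bigr => k _; rewrite mxE expr2.
Qed.

End OrthonormalFamily.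

(** * Second moments of features and linear functions under coverage *)

Section SecondMoments.
Set Implicit Arguments. Unset Strict Implicit.
Context {R : realType} {U : Type} {d : nat}.
Variables (B : (U -> R) -> Prop) (feat : U -> 'I_d -> R).
Hypothesis bfeat : forall i, B (fun u => feat u i).
Implicit Type L : (U -> R) -> R.

Definition moment L : 'M[R]_d := \matrix_(i, j) L (fun u => feat u i * feat u j).

Lemma alg_dotv (HB : function_algebra B) (x : 'I_d -> R) :
  B (fun u => dotv (feat u) x).
Proof.
apply: (alg_sum HB) => i; apply: (alg_mul HB) => //; exact: (alg_cst HB).
Qed.

Lemma quadf_moment L (x : 'cV[R]_d) : expectation_on B L ->
  quadf (moment L) x = L (fun u => dotv (feat u) (x^~ 0) ^+ 2).
Proof.
move=> EL; have HB := expect_alg EL.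
rewrite (_ : (fun u => _) = (fun u => \sum_i \sum_j
    (x i 0 * x j 0) * (feat u i * feat u j))); last first.
  apply/funext => u; rewrite expr2 /dotv mulr_suml; apply: eq_bigr => i _.
  rewrite mulr_sumr; apply: eq_bigr => j _; ring.
have bff i j : B (fun u => feat u i * feat u j) by exact: (alg_mul HB).
rewrite (expect_sum EL); last first.
  by move=> i; apply: (alg_sum HB) => j; exact: (alg_scale HB).
have bsc i j c : B (fun u => c * (feat u i * feat u j)) by exact: (alg_scale HB).
under [RHS]eq_bigr => i _ do rewrite (expect_sum EL _ (fun j => bsc i j _)).
rewrite [RHS]exchange_big/= /quadf mxE; apply: eq_bigr => j _.
rewrite mxE mulr_suml; apply: eq_bigr => i _; rewrite (expectZ EL)// !mxE.
rewrite (_ : (fun u => feat u i * feat u j) = (fun u => feat u j * feat u i)).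
  by ring.
by apply/funext => u; rewrite mulrC.
Qed.

Lemma moment_sym L : (moment L)^T = moment L.
Proof.
apply/matrixP => i j; rewrite !mxE; congr L.
by apply/funext => u; rewrite mulrC.
Qed.

Lemma quadf_moment_ge0 L x : expectation_on B L -> 0 <= quadf (moment L) x.
Proof.
move=> EL; rewrite quadf_moment//; apply: (expect_ge0 EL) => [|u]; last exact: sqr_ge0.
by apply: (alg_sqr (expect_alg EL)); apply: alg_dotv; exact: expect_alg EL.
Qed.

(* Coverage of the sum of the [L t] by [Lr] bounds the trace of the summed second moments
   in a [Lr]-orthonormal family, whose size is at most the rank. *)
Lemma sum_linear_expect_le (H : nat) (L : nat -> (U -> R) -> R) (Lr : (U -> R) -> R)
    (C W : R) (w : nat -> 'I_d -> R) :
  (forall t, expectation_on B (L t)) -> expectation_on B Lr -> 0 <= C -> 0 <= W ->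
  (forall x, \sum_(t < H) L t (fun u => dotv (feat u) x ^+ 2) <=
             C * Lr (fun u => dotv (feat u) x ^+ 2)) ->
  (forall t, Lr (fun u => dotv (feat u) (w t) ^+ 2) <= W ^+ 2) ->
  \sum_(t < H) L t (fun u => dotv (feat u) (w t)) <=
  Num.sqrt (H%:R * C * (\rank (moment Lr))%:R) * W.
Proof.
move=> EL ELr C0 W0 cov hW; have HB := expect_alg ELr.
pose M := moment Lr.
have bdot x : B (fun u => dotv (feat u) x) by exact: alg_dotv.
have bsq x : B (fun u => dotv (feat u) x ^+ 2) by exact: alg_sqr.
have [r [X [rM XMX Xmax]]] := maximal_orthonormal_family (moment_sym Lr)
  (fun x => quadf_moment_ge0 x ELr).
have psq t x : 0 <= L t (fun u => dotv (feat u) x ^+ 2).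
  by apply: (expect_ge0 (EL t)) => // u; exact: sqr_ge0.
pose s t := \sum_k L t (fun u => dotv (feat u) (X^~ k) ^+ 2).
have s0 t : 0 <= s t by exact: sumr_ge0.
have sle : \sum_(t < H) s t <= C * (\rank M)%:R.
  rewrite exchange_big/=; apply: (@le_trans _ _ (\sum_(k < r) C)).
    apply: ler_sum => k _; apply: le_trans (cov _) _.
    rewrite ler_piMr// le_eqVlt; apply/orP; left; apply/eqP.
    have := quadf_moment (col k X) ELr; rewrite (_ : (col k X)^~ 0 = X^~ k); last first.
      by apply/funext => i; rewrite mxE.
    move=> <-; have /matrixP/(_ k k) := XMX; rewrite [RHS]mxE eqxx mulr1n => <-.
    rewrite /quadf [LHS]mxE [RHS]mxE; apply: eq_bigr => j _.
    congr (_ * _); last by rewrite mxE.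
    by rewrite [LHS]mxE [RHS]mxE; apply: eq_bigr => i _; rewrite !mxE.
  by rewrite sumr_const card_ord -[_ *+ _]mulr_natr ler_wpM2l// ler_nat.
have term (t : 'I_H) : L t (fun u => dotv (feat u) (w t)) <= W * Num.sqrt (s t).
  pose wt : 'cV[R]_d := \col_i w t i.
  have wtE : wt^~ 0 = w t by apply/funext => i; rewrite mxE.
  have [Xu wq] := quadf_orthonormal wt (moment_sym Lr) XMX.
  set v := X^T *m moment Lr *m wt in Xu wq; set z := wt - X *m v in Xu wq.
  have qz : quadf (moment Lr) z = 0 by exact: Xmax.
  have vW : \sum_k v k 0 ^+ 2 <= W ^+ 2.
    by have := hW t; rewrite -wtE -quadf_moment// wq qz addr0.
  (* Coverage transfers null directions: the residual [z] has zero second moment under [Lr], hence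
     under [L t], so its mean vanishes too. *)
  have Lz : L t (fun u => dotv (feat u) (z^~ 0)) <= 0.
    have : \sum_(t < H) L t (fun u => dotv (feat u) (z^~ 0) ^+ 2) <= 0.
      by apply: le_trans (cov _) _; rewrite -quadf_moment// qz mulr0.
    rewrite (bigD1 t)//= => h; have : L t (fun u => dotv (feat u) (z^~ 0) ^+ 2) <= 0.
      by apply: le_trans h; rewrite lerDl sumr_ge0.
    move/(le_trans (expect_sqr_le (EL t) (bdot (z^~ 0)))).
    by move=> ?; rewrite leNgt; apply/negP => ?; nra.
  pose y u := \sum_k v k 0 * dotv (feat u) (X^~ k).
  have By : B y.
    by apply: (alg_sum HB) => k; exact: (alg_scale HB).
  have Ly : L t y <= W * Num.sqrt (s t).
    have Ly2 : L t (fun u => y u ^+ 2) <= W ^+ 2 * s t.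
      have -> : W ^+ 2 * s t = L t (fun u => W ^+ 2 *
          \sum_k dotv (feat u) (X^~ k) ^+ 2).
        rewrite (expectZ (EL t)) ?(expect_sum (EL t))//.
        by apply: (alg_sum HB).
      apply: (expect_le (EL t)).
      - exact: (alg_sqr HB).
      - by apply: (alg_scale HB); exact: (alg_sum HB).
      - move=> u; apply: le_trans (sqr_dotv_le _ _) _.
        by rewrite ler_wpM2r// sumr_ge0// => k _; exact: sqr_ge0.
    have := le_trans (expect_sqr_le (EL t) By) Ly2.
    rewrite -[s t]sqr_sqrtr// -exprMn => h.
    rewrite leNgt; apply/negP => lt.
    have : 0 <= W * Num.sqrt (s t) by rewrite mulr_ge0 ?sqrtr_ge0.
    rewrite sqr_sqrtr// in lt; nra.
  rewrite (_ : (fun u => _) = fun u => y u + dotv (feat u) (z^~ 0)).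
    by rewrite (expectD (EL t))//; lra.
  apply/funext => u; rewrite -wtE /y /dotv.
  under [X in _ = X + _]eq_bigr => k _ do rewrite mulr_sumr.
  rewrite exchange_big -big_split/=; apply: eq_bigr => i _.
  have -> : z i 0 = wt i 0 - \sum_k X i k * v k 0.
    by rewrite mxE; congr (_ + _); rewrite mxE; congr (- _); rewrite mxE.
  rewrite mulrBr mulr_sumr.
  rewrite [X in _ = X + _](_ : _ = \sum_k feat u i * (X i k * v k 0)).
    by rewrite addrC subrK.
  by apply: eq_bigr => k _; ring.
apply: le_trans (ler_sum _ (fun t _ => term t)) _.
rewrite -mulr_sumr mulrC ler_wpM2r//.
(* Cauchy-Schwarz over the [H] times is where the factor [H] under the root arises. *)
have sq : (\sum_(t < H) Num.sqrt (s t)) ^+ 2 <= H%:R * C * (\rank M)%:R.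
  have := sqr_dotv_le (fun=> 1) (fun t : 'I_H => Num.sqrt (s t)).
  rewrite /dotv; under eq_bigr do rewrite mul1r.
  under [X in X * _]eq_bigr do rewrite expr1n.
  under [X in _ * X]eq_bigr do rewrite sqr_sqrtr//.
  rewrite sumr_const card_ord => /le_trans; apply.
  by rewrite -mulrA ler_wpM2l// ler0n.
rewrite -[leLHS]ger0_norm ?sumr_ge0//.
by rewrite -sqrtr_sqr ler_wsqrtr.
Qed.

End SecondMoments.

(** * Low-rank transition densities *)

Section LowRank.
Set Implicit Arguments. Unset Strict Implicit.
Context {R : realType} {dS : measure_display} {S : measurableType dS} {A : finType}.
Variable (lam : {measure set S -> \bar R}).

Lemma Rintegral_sumZ (I : Type) (s : seq I) (c : I -> R) (g : I -> S -> R) :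
  (forall i, lam.-integrable setT (EFin \o g i)) ->
  Rintegral lam setT (fun x => \sum_(i <- s) c i * g i x) =
  \sum_(i <- s) c i * Rintegral lam setT (g i).
Proof.
move=> ig.
have icg i : lam.-integrable setT (EFin \o (fun x => c i * g i x)).
  by have := integrableZl measurableT (c i) (ig i).
elim: s => [|i s IH].
  rewrite big_nil; under eq_Rintegral do rewrite big_nil.
  by rewrite Rintegral_cst// mul0r.
rewrite big_cons; under eq_Rintegral do rewrite big_cons.
rewrite RintegralD// ?IH ?RintegralZl//.
have := @integrable_sum _ _ _ lam setT measurableT _ s xpredT
  (fun i x => (c i * g i x)%:E) (fun i _ => icg i).
by apply: eq_integrable => // x _; rewrite /= sumEFin.
Qed.

Record lowrank_model (d : nat) (mu : S -> 'I_d -> R) (phi : S -> A -> 'I_d -> R) :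
    Prop := LowrankModel {
  lowrank_integrable : forall i, lam.-integrable setT (EFin \o mu^~ i);
  lowrank_bmeas : forall a i, bmeas (fun s => phi s a i);
  lowrank_ge0 : forall s a s', 0 <= dotv (mu s') (phi s a);
  lowrank_int1 : forall s a, (\int[lam]_s' (dotv (mu s') (phi s a))%:E = 1)%E }.

Definition lowrank_density (d : nat) (mu : S -> 'I_d -> R) (phi : S -> A -> 'I_d -> R)
  : tdens := fun s a s' => dotv (mu s') (phi s a).

Section Model.
Context {d : nat} {mu : S -> 'I_d -> R} {phi : S -> A -> 'I_d -> R}.
Hypothesis M : lowrank_model mu phi.
Let P := lowrank_density mu phi.

Lemma lowrank_density_integrable s a : lam.-integrable setT (EFin \o P s a).
Proof.
rewrite (_ : _ \o _ = fun s' => \sum_i (phi s a i)%:E * (mu s' i)%:E)%E.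
  apply: integrable_sum => // i _.
  have := integrableZl measurableT (phi s a i) (lowrank_integrable M i).
  by [].
apply/funext => s' /=; rewrite -sumEFin; apply: eq_bigr => i _.
by rewrite -EFinM mulrC.
Qed.

Lemma lowrank_density_measurable s a : measurable_fun setT (P s a).
Proof.
by apply/measurable_EFinP; case/integrableP : (lowrank_density_integrable s a).
Qed.

Lemma lowrank_density_expect s a :
  expectation_on bmeas (fun f => Rintegral lam setT (fun s' => P s a s' * f s')).
Proof.
apply: expectation_density; [exact: (lowrank_ge0 M)| |exact: (lowrank_int1 M)].
exact: lowrank_density_measurable.
Qed.

(** The one use of the low-rank structure: every next-step expectation is linear in [phi s a], with
    a weight independent of [(s, a)]. Measurability of the kernel in [s] follows without any product
    measure. *)
Lemma lowrank_density_Rintegral s a f : bmeas f ->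
  Rintegral lam setT (fun s' => P s a s' * f s') =
  dotv (phi s a) (fun i => Rintegral lam setT (fun s' => mu s' i * f s')).
Proof.
move=> bf; rewrite /dotv -Rintegral_sumZ; last first.
  by move=> i; apply: integrableM_bmeas => //; exact: (lowrank_integrable M).
apply: eq_Rintegral => s' _; rewrite /P /lowrank_density /dotv mulr_suml.
by apply: eq_bigr => i _; rewrite mulrCA mulrA.
Qed.

Lemma lowrank_transition_kernel : transition_kernel lam P.
Proof.
split; first exact: lowrank_density_expect.
move=> f a bf; under eq_fun do rewrite lowrank_density_Rintegral//.
apply: (alg_sum bmeas_algebra) => i; apply: (alg_mul bmeas_algebra).
  exact: (lowrank_bmeas M).
exact: (alg_cst bmeas_algebra).
Qed.

End Model.

(** [A] is a bare finite type without a sigma-algebra, so regularity on pairs is required action by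
    action. *)
Definition sabmeas (g : S * A -> R) : Prop := forall a, bmeas (fun s => g (s, a)).

Lemma sabmeas_algebra : function_algebra sabmeas.
Proof.
split.
- by move=> c a; exact: (alg_cst bmeas_algebra).
- by move=> f g bf bg a; exact: (alg_add bmeas_algebra).
- by move=> f g bf bg a; exact: (alg_mul bmeas_algebra).
Qed.

Lemma expectation_average (L : (S -> R) -> R) (pi : nat -> S -> A -> R) (t : nat) :
  markov_policy pi -> expectation_on bmeas L ->
  expectation_on sabmeas (fun g => L (fun s => \sum_a pi t s a * g (s, a))).
Proof.
move=> mpi EL; have bavg g : sabmeas g -> bmeas (fun s => \sum_a pi t s a * g (s, a)).
  by move=> bg; exact: (policy_avg_bmeas mpi t (g := fun s a => g (s, a))).
case: (mpi) => pi0 pi1 _; split; first exact: sabmeas_algebra.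
- move=> f g bf bg; rewrite -(expectD EL); [|exact: bavg..].
  congr L; apply/funext => s; rewrite -big_split.
  by apply: eq_bigr => a _; rewrite mulrDr.
- move=> c f bf; rewrite -(expectZ EL); last exact: bavg.
  congr L; apply/funext => s; rewrite mulr_sumr.
  by apply: eq_bigr => a _; rewrite mulrCA.
- move=> f bf f0; apply: (expect_ge0 EL); first exact: bavg.
  by move=> s; apply: sumr_ge0 => a _; rewrite mulr_ge0.
- rewrite -[RHS](expect1 EL); congr L; apply/funext => s.
  by under eq_bigr do rewrite mulr1.
Qed.

End LowRank.

(** * From model error to the value gap *)

Section Regret.
Set Implicit Arguments. Unset Strict Implicit.
Context {R : realType} {dS : measure_display} {S : measurableType dS} {A : finType}.
Variables (lam : {measure set S -> \bar R}) (d0 : probability S R) (d : nat).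
Variables (mu mu' : S -> 'I_d -> R) (phi phi' : S -> A -> 'I_d -> R).
Hypotheses (M : lowrank_model lam mu phi) (M' : lowrank_model lam mu' phi').
Let P : tdens := lowrank_density mu phi.
Let Q : tdens := lowrank_density mu' phi'.
Let l (s : S) (a : A) := l1dist lam Q P s a.
Hypothesis bl : forall a, bmeas (fun s => l s a).
Variables (pi : nat -> S -> A -> R) (mpi : markov_policy pi).

Let kP : transition_kernel lam P := lowrank_transition_kernel M.
Let kQ : transition_kernel lam Q := lowrank_transition_kernel M'.

Lemma l1dist_ge0 s a : 0 <= l s a.
Proof. by apply: Rintegral_ge0. Qed.

(* Centring [V] at [b / 2] gains the factor [1 / 2]. *)
Lemma step_diff_le t V b s : bmeas V -> (forall x, 0 <= V x <= b) ->
  step lam P pi t V s - step lam Q pi t V s <= b / 2 * \sum_a pi t s a * l s a.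
Proof.
move=> bV V0b; case: (mpi) => pi0 _ _.
rewrite /step -sumrB mulr_sumr; apply: ler_sum => a _.
rewrite -mulrBr mulrCA ler_wpM2l//.
pose V' x := V x - b / 2.
have bc : bmeas (fun _ : S => b / 2) by exact: (alg_cst bmeas_algebra).
have bV' : bmeas V' by exact: (alg_sub bmeas_algebra).
have EP := kernel_expect kP s a; have EQ := kernel_expect kQ s a.
have PV' := expectB EP bV bc; have QV' := expectB EQ bV bc.
rewrite (expect_cst EP) -/(V' _) in PV'; rewrite (expect_cst EQ) -/(V' _) in QV'.
set IP := Rintegral _ _ _; set IQ := Rintegral _ _ _.
rewrite (_ : IP - IQ = (IP - b / 2) - (IQ - b / 2)); last by ring.
rewrite -PV' -QV'.
have iP := lowrank_density_integrable M s a.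
have iQ := lowrank_density_integrable M' s a.
rewrite -RintegralB//; [|exact: integrableM_bmeas..].
have iPQ : lam.-integrable setT (EFin \o (fun s' => `|Q s a s' - P s a s'|)).
  by have := integrable_abse (integrableB measurableT iQ iP).
rewrite -RintegralZl//; apply: le_Rintegral => //.
- by have := integrableB measurableT (integrableM_bmeas iP bV') (integrableM_bmeas iQ bV').
- by have := integrableZl measurableT (b / 2) iPQ.
move=> s' _; rewrite -mulrBl.
have /andP[V0 Vb] := V0b s'.
have VV : `|V' s'| <= b / 2 by rewrite /V' ler_norml; lra.
rewrite (le_trans (ler_norm _))// normrM (mulrC (b / 2)) distrC ler_wpM2l//.
Qed.

Lemma occ_expectation t :
  expectation_on sabmeas (fun f => occ_exp lam d0 P pi t (fun s a => f (s, a))).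
Proof. exact: expectation_average (state_expect d0 mpi t kP). Qed.

Lemma occ_l1dist_ge0 t : 0 <= occ_exp lam d0 P pi t l.
Proof.
apply: (expect_ge0 (occ_expectation t) (f := fun u => l u.1 u.2)) => //.
by move=> u; exact: l1dist_ge0.
Qed.

Section Value.
Variables (r : S -> A -> R) (H : nat).
Hypotheses (r01 : forall s a, 0 <= r s a <= 1)
  (mr : forall a, measurable_fun setT (fun s => r s a)).

Let g t s := \sum_a pi t s a * r s a.

Let br a : bmeas (fun s => r s a).
Proof.
split; first exact: mr.
by exists 1 => s; have /andP[? ?] := r01 s a; rewrite ger0_norm.
Qed.

Let bg t : bmeas (g t).
Proof. exact: policy_avg_bmeas. Qed.

Let g01 t s : 0 <= g t s <= 1.
Proof.
case: mpi => pi0 pi1 _; rewrite /g; apply/andP; split.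
  by apply: sumr_ge0 => a _; have /andP[? ?] := r01 s a; rewrite mulr_ge0.
rewrite -(pi1 t s); apply: ler_sum => a _.
by have /andP[? ?] := r01 s a; rewrite ler_piMr.
Qed.

Lemma value_ge0 : 0 <= value lam d0 H r P pi.
Proof.
apply: sumr_ge0 => t _.
apply: (expect_ge0 (occ_expectation t) (f := fun u => r u.1 u.2)) => //.
by move=> u; have /andP[] := r01 u.1 u.2.
Qed.

Lemma value_diff_le :
  value lam d0 H r P pi - value lam d0 H r Q pi <=
  \sum_(t < H) (H - t.+1)%:R / 2 * occ_exp lam d0 P pi t l.
Proof.
rewrite /value /occ_exp (simulation d0 mpi bg H kP kQ).
apply: ler_sum => t _; have E := state_expect d0 mpi t kP.
have bV := vfun_bmeas mpi bg t.+1 (H - t.+1) kQ.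
have bavg : bmeas (fun s => \sum_a pi t s a * l s a) by exact: policy_avg_bmeas.
rewrite -(expectZ E)//; apply: (expect_le E).
- by apply: (alg_sub bmeas_algebra); exact: step_bmeas.
- exact: (alg_scale bmeas_algebra).
- move=> s; apply: step_diff_le => // x.
  by apply: vfun_bounds.
Qed.

End Value.

Variables (pib : S -> A -> R) (rho : S -> R) (pmin : R).
Hypotheses (mpib : markov_policy (fun _ => pib)) (rho0 : forall s, 0 <= rho s)
  (mrho : measurable_fun setT rho) (rho1 : (\int[lam]_s (rho s)%:E = 1)%E).
Hypothesis rho_stat : forall s, rho s = Rintegral lam setT (fun s' =>
  rho s' * \sum_a' pib s' a' * dotv (mu s) (phi s' a')).
Hypotheses (pmin0 : 0 < pmin) (pminP : forall s a, pmin <= pib s a).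

Let Erho := expectation_density rho0 mrho rho1.

Lemma rho_expectation :
  expectation_on sabmeas (fun f => rho_exp lam rho pib (fun s a => f (s, a))).
Proof. exact: (expectation_average 0 mpib Erho). Qed.

Let bphi i : sabmeas (fun u : S * A => phi u.1 u.2 i).
Proof. by move=> a; exact: (lowrank_bmeas M). Qed.

Let bdot (x : 'I_d -> R) : sabmeas (fun u : S * A => dotv (phi u.1 u.2) x).
Proof. by apply: alg_dotv => //; exact: sabmeas_algebra. Qed.

(** The hypothesis is stationarity of the density pointwise; against a test function it would
    require exchanging two integrals over [lam]. Instead it says that [rho] is a combination of the
    coordinates of [mu], and only finite sums are exchanged. *)
Lemma rho_stationary f : bmeas f ->
  rho_exp lam rho pib (fun s a => Rintegral lam setT (fun s' => P s a s' * f s')) =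
  Rintegral lam setT (fun s => rho s * f s).
Proof.
move=> bf.
pose c i := rho_exp lam rho pib (fun s a => phi s a i).
have EL := rho_expectation.
have rhoE s : rho s = \sum_i c i * mu s i.
  have bs i : sabmeas (fun u : S * A => mu s i * phi u.1 u.2 i).
    exact: (alg_scale sabmeas_algebra).
  transitivity (rho_exp lam rho pib (fun s' a => \sum_i mu s i * phi s' a i)).
    exact: rho_stat.
  have /= := expect_sum EL (index_enum 'I_d) bs => ->.
  by apply: eq_bigr => i _; rewrite mulrC; have /= -> := expectZ EL (mu s i) (bphi i).
have -> : Rintegral lam setT (fun s => rho s * f s) =
    \sum_i c i * Rintegral lam setT (fun s => mu s i * f s).
  rewrite -Rintegral_sumZ => [|i]; last first.
    by apply: integrableM_bmeas => //; exact: (lowrank_integrable M).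
  apply: eq_Rintegral => s _; rewrite rhoE mulr_suml.
  by apply: eq_bigr => i _; rewrite mulrA.
pose I i := Rintegral lam setT (fun s => mu s i * f s).
rewrite (_ : (fun s a => _) = fun s a => \sum_i I i * phi s a i); last first.
  apply/funext => s; apply/funext => a; rewrite lowrank_density_Rintegral//.
  by apply: eq_bigr => i _; rewrite mulrC.
have bs i : sabmeas (fun u : S * A => I i * phi u.1 u.2 i).
  exact: (alg_scale sabmeas_algebra).
have /= -> := expect_sum EL (index_enum 'I_d) bs.
by apply: eq_bigr => i _; rewrite mulrC; have /= -> := expectZ EL (I i) (bphi i).
Qed.

Let fl t (s : S) := \sum_a pi t s a * l s a.
Let w t (i : 'I_d) := Rintegral lam setT (fun s' => mu s' i * fl t.+1 s').

Let bfl t : bmeas (fl t).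
Proof. exact: policy_avg_bmeas. Qed.

Lemma occ_back t :
  occ_exp lam d0 P pi t.+1 l = occ_exp lam d0 P pi t (fun s a => dotv (phi s a) (w t)).
Proof.
rewrite /occ_exp /=; congr state_exp; apply/funext => s; rewrite /step.
by apply: eq_bigr => a _; rewrite lowrank_density_Rintegral//; exact: bfl.
Qed.

(** Jensen under [P] moves the square inside, stationarity brings the next state back to [rho], and
    the action law is changed from [pi] to [pib] at cost [pmin^-1], because
    [pi <= 1 <= pib / pmin]. *)
Lemma rho_exp_w_le t :
  rho_exp lam rho pib (fun s a => dotv (phi s a) (w t) ^+ 2) <=
  pmin^-1 * rho_exp lam rho pib (fun s a => l s a ^+ 2).
Proof.
have EL := rho_expectation; case: (mpi) => pi0 pi1 _.
have bf2 := alg_sqr bmeas_algebra (bfl t.+1).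
have bl2 a : bmeas (fun s => l s a ^+ 2) by exact: (alg_sqr bmeas_algebra).
apply: (@le_trans _ _ (rho_exp lam rho pib (fun s a =>
    Rintegral lam setT (fun s' => P s a s' * fl t.+1 s' ^+ 2)))).
  apply: (expect_le EL (f := fun u => dotv (phi u.1 u.2) (w t) ^+ 2)
    (g := fun u => Rintegral lam setT (fun s' => P u.1 u.2 s' * fl t.+1 s' ^+ 2))).
  - by move=> a; apply: (alg_sqr bmeas_algebra); exact: (bdot (w t) a).
  - by move=> a; exact: (kernel_bmeas kP).
  - move=> u; rewrite -lowrank_density_Rintegral//.
    by have := expect_sqr_le (kernel_expect kP u.1 u.2) (bfl t.+1).
have bl2' : sabmeas (fun u : S * A => l u.1 u.2 ^+ 2) by [].
rewrite rho_stationary//.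
have /= <- := expectZ EL pmin^-1 bl2'.
apply: (expect_le Erho) => //.
  by apply: (policy_avg_bmeas mpib 0) => a; exact: (alg_scale bmeas_algebra).
move=> s; apply: le_trans (sqr_wsum_le _ _ _) _ => //.
apply: ler_sum => a _; rewrite mulrA ler_wpM2r ?sqr_ge0//.
rewrite ler_pdivlMr// (le_trans _ (pminP s a))// ger_pMl//.
by rewrite -(pi1 t.+1 s) (bigD1 a)//= lerDl sumr_ge0.
Qed.

(** Jensen, then [pi 0 s a <= 1], which is [#|A|] times the uniform weight. This change of action
    law is the source of the factor [#|A|] in the bound. *)
Lemma occ0_sqr_le : (0 < #|A|)%N ->
  occ_exp lam d0 P pi 0 l ^+ 2 <=
  #|A|%:R * Rintegral d0 setT (fun s => #|A|%:R^-1 * \sum_a l s a ^+ 2).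
Proof.
move=> A0; have E := expectation_probability d0; case: (mpi) => pi0 pi1 _.
have bl2 a : bmeas (fun s => l s a ^+ 2) by exact: (alg_sqr bmeas_algebra).
have bs : bmeas (fun s => \sum_a l s a ^+ 2) by exact: (alg_sum bmeas_algebra).
rewrite -(expectZ E); last exact: (alg_scale bmeas_algebra).
apply: le_trans (expect_sqr_le E (bfl 0)) _; apply: (expect_le E).
- exact: (alg_sqr bmeas_algebra).
- by do 2 apply: (alg_scale bmeas_algebra).
move=> s; rewrite mulrA divff ?mul1r; last by rewrite pnatr_eq0 -lt0n.
apply: le_trans (sqr_wsum_le _ _ _) _ => //.
apply: ler_sum => a _; rewrite ler_piMl ?sqr_ge0//.
by rewrite -(pi1 0%N s) (bigD1 a)//= lerDl sumr_ge0.
Qed.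

(** The hypothesis [4 * xi] is the largest error compatible with leading constant one: its root
    [2 * sqrt xi] is compensated exactly by the factor [1 / 2] gained from centring the value
    function. *)
Lemma regret_le (r : S -> A -> R) (H : nat) (xi C0 Cb : R) :
  (forall s a, 0 <= r s a <= 1) -> (forall a, measurable_fun setT (fun s => r s a)) ->
  (0 < #|A|)%N -> 0 <= xi -> 0 <= C0 -> 0 <= Cb ->
  rho_exp lam rho pib (fun s a => l s a ^+ 2) <= 4 * xi ->
  Rintegral d0 setT (fun s => #|A|%:R^-1 * \sum_a l s a ^+ 2) <=
    C0 * rho_exp lam rho pib (fun s a => l s a ^+ 2) ->
  (forall x, quadf (Sigma_pi lam d0 H phi P pi) x <=
    Cb * quadf (Sigma_rho lam rho pib phi) x) ->
  value lam d0 H r P pi - value lam d0 H r Q pi <=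
  Num.sqrt xi * Num.sqrt #|A|%:R * (H%:R * Num.sqrt C0 +
    H%:R ^+ 2 * Num.sqrt (Cb * (\rank (Sigma_rho lam rho pib phi))%:R / pmin)).
Proof.
move=> r01 mr A0 xi0 C00 Cb0 lxi hC0 hCb.
apply: le_trans (value_diff_le H r01 mr) _.
(* At horizon zero both sides vanish; afterwards the normalisation of [Sigma_pi] is a true
   inverse. *)
case: H hCb => [|H] hCb.
  by rewrite big_ord0 expr2 !mul0r addr0 mulr0.
have EL := rho_expectation; have Eocc := occ_expectation.
have l20 : 0 <= rho_exp lam rho pib (fun s a => l s a ^+ 2).
  apply: (expect_ge0 EL (f := fun u => l u.1 u.2 ^+ 2)) => [a|u]; last exact: sqr_ge0.
  exact: (alg_sqr bmeas_algebra (bl a)).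
set rk := (\rank _)%:R.
pose W := 2 * Num.sqrt (xi / pmin).
have rk0 : 0 <= rk by rewrite ler0n.
have first : occ_exp lam d0 P pi 0 l <= 2 * (Num.sqrt xi * Num.sqrt #|A|%:R * Num.sqrt C0).
  rewrite -ler_sqr ?nnegrE ?occ_l1dist_ge0 ?mulr_ge0 ?sqrtr_ge0//.
  apply: le_trans (occ0_sqr_le A0) _.
  rewrite !exprMn !sqr_sqrtr//.
  apply: le_trans (ler_wpM2l _ hC0) _ => //.
  apply: le_trans (ler_wpM2l _ (ler_wpM2l _ lxi)) _ => //.
  by rewrite le_eqVlt; apply/orP; left; apply/eqP; ring.
have W0 : 0 <= W by rewrite mulr_ge0// sqrtr_ge0.
have rest : \sum_(t < H.+1) occ_exp lam d0 P pi t.+1 l <=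
    H.+1%:R * Num.sqrt (Cb * rk) * W.
  under eq_bigr do rewrite occ_back.
  have := @sum_linear_expect_le _ _ _ _ (fun u => phi u.1 u.2) bphi H.+1
    (fun t f => occ_exp lam d0 P pi t (fun s a => f (s, a)))
    (fun f => rho_exp lam rho pib (fun s a => f (s, a))) (H.+1%:R * Cb) W w.
  move=> /(_ Eocc EL) /=; rewrite -/(Sigma_rho lam rho pib phi).
  rewrite (_ : moment _ _ = Sigma_rho lam rho pib phi)// -/rk => h.
  apply: le_trans (h _ _ _ _) _ => //.
  - by rewrite mulr_ge0.
  - move=> x; pose xc : 'cV[R]_d := \col_i x i.
    have xcE : xc^~ 0 = x by apply/funext => i; rewrite mxE.
    (* [Sigma_pi] is the moment matrix of the time average, so coverage of the sum over times holds
       with [H.+1 * Cb]. Together with Cauchy-Schwarz over time this gives the first of the two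
       horizon factors. *)
    have Eavg : expectation_on sabmeas (fun f => H.+1%:R^-1 *
        \sum_(t < H.+1) occ_exp lam d0 P pi t (fun s a => f (s, a))).
      split; first exact: sabmeas_algebra.
      + move=> f g bf bg; rewrite -mulrDr -big_split; congr (_ * _).
        by apply: eq_bigr => t _; exact: (expectD (Eocc t)).
      + move=> c f bf; rewrite mulrCA; congr (_ * _); rewrite mulr_sumr.
        by apply: eq_bigr => t _; exact: (expectZ (Eocc t)).
      + move=> f bf f0; rewrite mulr_ge0//; apply: sumr_ge0 => t _.
        exact: (expect_ge0 (Eocc t)).
      + under eq_bigr => t _ do rewrite (expect1 (Eocc t)).
        by rewrite sumr_const card_ord mulVf.
    have := hCb xc.
    have := quadf_moment bphi xc EL; rewrite xcE => /= <-.
    have := quadf_moment bphi xc Eavg; rewrite xcE => /= => Q1 Q2.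
    rewrite -mulrA -ler_pdivrMl//; rewrite -Q1; exact: Q2.
  - move=> t; apply: le_trans (rho_exp_w_le t) _.
    rewrite /W exprMn sqr_sqrtr ?divr_ge0 ?(ltW pmin0)//.
    apply: le_trans (ler_wpM2l _ lxi) _; first by rewrite invr_ge0 ltW.
    by rewrite le_eqVlt; apply/orP; left; apply/eqP; ring.
  rewrite (_ : H.+1%:R * (H.+1%:R * Cb) * rk = H.+1%:R ^+ 2 * (Cb * rk)); last by ring.
  by rewrite sqrtrM ?sqr_ge0// sqrtr_sqr ger0_norm.
have Hb (t : nat) : (H.+1 - t.+1)%:R / 2 <= H.+1%:R / 2 :> R.
  by rewrite ler_wpM2r// ler_nat leq_subr.
(* Looking back one step from all times covered by [Sigma_pi] reaches one time past the horizon;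
   that term is nonnegative and only enlarges the sum. *)
have tail : \sum_(t < H) occ_exp lam d0 P pi t.+1 l <=
    \sum_(t < H.+1) occ_exp lam d0 P pi t.+1 l.
  by rewrite big_ord_recr/= lerDl occ_l1dist_ge0.
have Wle : Num.sqrt (Cb * rk) * W <=
    2 * (Num.sqrt xi * Num.sqrt #|A|%:R * Num.sqrt (Cb * rk / pmin)).
  rewrite /W !(mulrC _ (pmin^-1)) !sqrtrM ?invr_ge0 ?mulr_ge0 ?(ltW pmin0)//.
  (* The later times come without [#|A|]; the factor is inserted here to share the prefactor of the
     initial term. *)
  have A1 : 1 <= Num.sqrt #|A|%:R :> R by rewrite -[leLHS]sqrtr1 ler_wsqrtr// ler1n.
  set a := Num.sqrt _ in A1 *; set x := Num.sqrt xi; set p := Num.sqrt pmin^-1.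
  have c0 : 0 <= Num.sqrt Cb * Num.sqrt rk * p * x by rewrite !mulr_ge0 ?sqrtr_ge0.
  have := ler_peMl c0 A1; lra.
apply: (@le_trans _ _ (H.+1%:R / 2 * \sum_(t < H.+1) occ_exp lam d0 P pi t l)).
  rewrite mulr_sumr; apply: ler_sum => t _; rewrite ler_wpM2r//.
  exact: occ_l1dist_ge0.
rewrite big_ord_recl/=.
have rest' : \sum_(t < H) occ_exp lam d0 P pi (bump 0 t) l <=
    H.+1%:R * (Num.sqrt (Cb * rk) * W).
  by rewrite mulrA; exact: le_trans tail rest.
have h : 0 <= H.+1%:R :> R by [].
have rest'' := le_trans rest' (ler_wpM2l h Wle).
have := ler_wpM2l (_ : 0 <= H.+1%:R / 2 :> R) (lerD first rest'').
rewrite divr_ge0// => /(_ isT) /le_trans; apply.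
by rewrite le_eqVlt; apply/orP; left; apply/eqP; field.
Qed.

End Regret.

(** * Expectations of products over independent samples *)

Section ProductExpectation.
Set Implicit Arguments. Unset Strict Implicit.
Context {R : realType} {d1 d2 dO : measure_display} {T1 : measurableType d1}
  {T2 : measurableType d2} {Omega : measurableType dO} {A : finType} {n : nat}.
Variables (Pr : probability Omega R) (nu : A -> {finite_measure set (T1 * T2)%type -> \bar R}).
Variables (X : 'I_n -> Omega -> T1 * T2) (Xa : 'I_n -> Omega -> A).
Hypotheses (mX : forall i, measurable_fun setT (X i))
  (mXa : forall i a, measurable [set w | Xa i w = a]).
Hypothesis indep : forall (B1 : 'I_n -> set T1) (B2 : 'I_n -> set T2) (al : 'I_n -> A),
  (forall i, measurable (B1 i)) -> (forall i, measurable (B2 i)) ->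
  Pr (\bigcap_(i in [set: 'I_n])
        [set w | B1 i (X i w).1 /\ Xa i w = al i /\ B2 i (X i w).2]) =
  (\prod_(i < n) fine (nu (al i) (B1 i `*` B2 i)))%:E.

Let term (al : 'I_n -> A) (G : 'I_n -> T1 * T2 -> R) i w :=
  \1_[set w | Xa i w = al i] w * G i (X i w).

Let term_ge0 al G i w : (forall u, 0 <= G i u) -> 0 <= term al G i w.
Proof. by move=> G0; rewrite mulr_ge0. Qed.

Let measurable_term al G i : measurable_fun setT (G i) ->
  measurable_fun setT (term al G i).
Proof.
move=> mG; apply: measurable_funM; first exact: measurable_indic.
exact: measurableT_comp.
Qed.

Definition is_rectangle (D : set (T1 * T2)%type) :=
  exists B1, measurable B1 /\ exists B2, measurable B2 /\ D = B1 `*` B2.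

Lemma rectangle_measure_unique (m1 m2 : {measure set (T1 * T2)%type -> \bar R}) :
  (forall D, is_rectangle D -> m1 D = m2 D) -> (m1 setT < +oo)%E ->
  forall D, measurable D -> m1 D = m2 D.
Proof.
move=> m12 fin1; apply: (measure_unique is_rectangle (fun=> setT)) => //.
- rewrite measurable_prod_measurableType; congr (<<s _ >>).
  rewrite predeqE; split => [[B1 mB1 [B2 mB2 <-]]|[B1 [mB1 [B2 [mB2 ->]]]]].
    by exists B1; split => //; exists B2.
  by exists B1 => //; exists B2.
- move=> _ _ [B1 [mB1 [B2 [mB2 ->]]]] [C1 [mC1 [C2 [mC2 ->]]]].
  rewrite -setXI; exists (B1 `&` C1); split; first exact: measurableI.
  by exists (B2 `&` C2); split => //; exact: measurableI.
- by move=> _; exists setT; split => //; exists setT; rewrite setXTT.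
- by rewrite bigcup_const.
Qed.

Lemma measurable_rectangle D : is_rectangle D -> measurable D.
Proof. by move=> [B1 [mB1 [B2 [mB2 ->]]]]; exact: measurableX. Qed.

(* Induction on the number [k] of leading coordinates whose factor is not a rectangle
   indicator; coordinate [k] is released by uniqueness of finite measures. *)
Let prod_integral_aux (al : 'I_n -> A) (k : nat) : forall (G : 'I_n -> T1 * T2 -> R) (c : 'I_n -> R),
  (forall i, measurable_fun setT (G i)) -> (forall i u, 0 <= G i u) ->
  (forall i, (\int[nu (al i)]_u (G i u)%:E = (c i)%:E)%E) ->
  (forall i : 'I_n, (k <= i)%N -> exists2 D, is_rectangle D & G i = \1_D) ->
  (\int[Pr]_w (\prod_(i < n) term al G i w)%:E = (\prod_(i < n) c i)%:E)%E.
Proof.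
elim: k => [|k IH] G c mG G0 Gc rectG.
  have {}rectG i : exists B : set T1 * set T2,
      [/\ measurable B.1, measurable B.2 & G i = \1_(B.1 `*` B.2)].
    by have [//|_ [B1 [mB1 [B2 [mB2 ->]]]] ->] := rectG i; exists (B1, B2).
  have [B HB] := choice rectG.
  pose E i := [set w | (B i).1 (X i w).1 /\ Xa i w = al i /\ (B i).2 (X i w).2].
  have mB1 i : measurable (B i).1 by case: (HB i).
  have mB2 i : measurable (B i).2 by case: (HB i).
  have termE i w : term al G i w = \1_(E i) w.
    case: (HB i) => _ _ GE; rewrite /term GE !indicE -natrM mulnb.
    by congr ((nat_of_bool _)%:R); apply/andP/idP => [[]|]; rewrite !inE /E /= => *; tauto.
  have mE i : measurable (E i).
    have -> : E i = X i @^-1` ((B i).1 `*` (B i).2) `&` [set w | Xa i w = al i].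
      by apply/seteqP; split => w /=; rewrite /E /=; tauto.
    apply: measurableI => //; rewrite -[X in measurable X]setTI.
    by apply: mX => //; exact: measurableX.
  under eq_integral => w _ do under eq_bigr do rewrite termE.
  have prodE w : \prod_(i < n) \1_(E i) w = \1_(\bigcap_(i in setT) E i) w :> R.
    rewrite indicE; case: (boolP (w \in _)) => [|].
      rewrite inE => wE; rewrite big1// => i _; rewrite indicE mem_set//; exact: wE.
    move=> /negP; rewrite inE => wE.
    have [i nEi] : exists i, ~ E i w.
      by apply: contra_notP wE => /forallNP h i _; have := h i => /contrapT.
    by rewrite (bigD1 i)//= indicE memNset// mul0r.
  under eq_integral => w _ do rewrite prodE.
  rewrite integral_indic//; last first.
    by apply: fin_bigcap_measurable => //; exact: finite_finset.
  rewrite setIT.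
  transitivity (\prod_(i < n) fine (nu (al i) ((B i).1 `*` (B i).2)))%:E.
    exact: indep.
  congr (_%:E); apply: eq_bigr => i _.
  have := Gc i; case: (HB i) => m1 m2 ->.
  by rewrite integral_indic ?setIT//; [move=> ->|exact: measurableX].
have [kn|nk] := ltnP k n; last first.
  apply: IH => // i ki; apply: rectG.
  by have := leq_trans nk ki; rewrite leqNgt ltn_ord.
pose j := Ordinal kn.
pose W w := (\prod_(i < n | i != j) term al G i w) * \1_[set w | Xa j w = al j] w.
pose c' := \prod_(i < n | i != j) c i.
have c0 i : 0 <= c i by rewrite -lee_fin -Gc; apply: integral_ge0 => u _; rewrite lee_fin.
have c'0 : 0 <= c' by exact: prodr_ge0.
have W0 w : 0 <= W w.
  by rewrite mulr_ge0// prodr_ge0// => i _; apply: term_ge0.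
have mW : measurable_fun setT W.
  apply: measurable_funM; last exact: measurable_indic.
  under eq_fun do rewrite big_mkcond/=.
  apply: measurable_prod => i _; case: (i != j); last exact: measurable_cst.
  exact: measurable_term.
have splitE G' w : (forall i, i != j -> G' i = G i) ->
    \prod_(i < n) term al G' i w = G' j (X j w) * W w.
  move=> G'G; rewrite (bigD1 j)//= /W.
  rewrite (eq_bigr (fun i => term al G i w)) => [|i ij]; last by rewrite /term G'G.
  by rewrite [X in X * _ = _]/term; ring.
(* With the indicator of a rectangle in place of [G j], only coordinates before [k] remain
   arbitrary, so the induction hypothesis applies. *)
have rect D : is_rectangle D ->
    (\int[Pr]_w (\1_D (X j w) * W w)%:E = (c' * fine (nu (al j) D))%:E)%E.
  move=> rD; have mD := measurable_rectangle rD.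
  pose G' i := if i == j then \1_D else G i.
  pose cc i := if i == j then fine (nu (al j) D) else c i.
  have ccE : \prod_(i < n) cc i = c' * fine (nu (al j) D).
    rewrite (bigD1 j)//= mulrC; congr (_ * _); last by rewrite /cc eqxx.
    by apply: eq_bigr => i ij; rewrite /cc (negPf ij).
  rewrite -ccE -(IH G').
  - apply: eq_integral => w _; rewrite splitE ?/G' ?eqxx// => i ij.
    by rewrite (negPf ij).
  - by move=> i; rewrite /G'; case: ifP => // _; exact: measurable_indic.
  - by move=> i u; rewrite /G'; case: ifP.
  - move=> i; rewrite /G' /cc; case: eqP => [->|//].
    by rewrite integral_indic// setIT fineK// fin_num_measure.
  - move=> i ki; rewrite /G'; case: eqP => [_|/eqP ij]; first by exists D.
    apply: rectG; rewrite ltn_neqAle ki andbT eq_sym.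
    by apply: contra ij => /eqP ik; apply/eqP/val_inj.
have rectT : is_rectangle [set: T1 * T2].
  by exists setT; split => //; exists setT; rewrite setXTT.
have intW : (\int[Pr]_w (W w)%:E < +oo)%E.
  have := rect _ rectT; under eq_integral do rewrite indicT mul1r.
  by move=> ->; exact: ltry.
(* [W], made of all factors except [G j], becomes a density on the sample space. Its image under
   [X j] agrees on rectangles with a multiple of [nu (al j)], hence everywhere. *)
pose mu1 := dens_measure W0 mW intW.
pose m1 : {measure set (T1 * T2)%type -> \bar R} := pushforward mu1 (X j).
pose m2 : {measure set (T1 * T2)%type -> \bar R} := mscale (NngNum c'0) (nu (al j)).
have int_m1 (h : (T1 * T2)%type -> R) : measurable_fun setT h -> (forall u, 0 <= h u) ->
    (\int[m1 (mX j)]_u (h u)%:E = \int[Pr]_w (h (X j w) * W w)%:E)%E.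
  move=> mh h0; rewrite ge0_integral_pushforward//; last 2 first.
  - exact/measurable_EFinP.
  - by move=> u _; rewrite lee_fin.
  rewrite preimage_setT integral_dens_measure//.
  - by apply/measurable_EFinP; exact: (measurableT_comp mh).
  - by move=> w; rewrite lee_fin.
have m1E D : is_rectangle D -> m1 (mX j) D = m2 D.
  move=> rD; have mD := measurable_rectangle rD.
  have := integral_indic (m1 (mX j)) measurableT mD.
  rewrite setIT => <-; rewrite (int_m1 \1_D) ?measurable_indic//.
  by rewrite rect// /m2 /= /mscale/= EFinM fineK// fin_num_measure.
have m12 : forall D, measurable D -> m1 (mX j) D = m2 D.
  apply: (rectangle_measure_unique m1E).
  by rewrite m1E// /m2 /= /mscale/= lte_mul_pinfty// ltey_eq fin_num_measure.
under eq_integral => w _ do rewrite (splitE G w (fun i _ => erefl)).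
rewrite -int_m1// (eq_measure_integral m2) => [|D mD _]; last exact: m12.
rewrite ge0_integral_mscale//=; last 2 first.
- exact/measurable_EFinP.
- by move=> u _; rewrite lee_fin.
by rewrite Gc (bigD1 j)//= -EFinM mulrC.
Qed.

Lemma prod_expectation (F : 'I_n -> T1 * T2 -> A -> R) (c : 'I_n -> A -> R) :
  (forall i a, measurable_fun setT (fun u => F i u a)) ->
  (forall i u a, 0 <= F i u a) ->
  (forall i a, (\int[nu a]_u (F i u a)%:E = (c i a)%:E)%E) ->
  (\int[Pr]_w (\prod_(i < n) F i (X i w) (Xa i w))%:E =
   (\prod_(i < n) \sum_a c i a)%:E)%E.
Proof.
move=> mF F0 Fc.
pose G (al : {ffun 'I_n -> A}) i u := F i u (al i).
(* For each [w] exactly one assignment of actions has all its indicators equal to one, so the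
   product splits into terms with the actions fixed. *)
have FE w : \prod_(i < n) F i (X i w) (Xa i w) =
    \sum_(al : {ffun 'I_n -> A}) \prod_(i < n) term al (G al) i w.
  rewrite -(bigA_distr_bigA (fun i a => \1_[set w | Xa i w = a] w * F i (X i w) a)).
  apply: eq_bigr => i _; rewrite (bigD1 (Xa i w))//= indicE mem_set//= mul1r.
  rewrite big1 ?addr0// => a aX; rewrite indicE memNset ?mul0r//= => Xwa.
  by rewrite Xwa eqxx in aX.
under eq_integral => w _ do rewrite FE -sumEFin.
rewrite ge0_integral_sum//; last 2 first.
- move=> al; apply/measurable_EFinP; apply: measurable_prod => i _.
  by apply: measurable_term; exact: mF.
- move=> al w _; rewrite lee_fin prodr_ge0// => i _.
  by apply: term_ge0 => u; exact: F0.
rewrite bigA_distr_bigA -sumEFin; apply: eq_bigr => al _.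
apply: (@prod_integral_aux al n (G al) (fun i => c i (al i))) => //.
- by move=> i; exact: mF.
- by move=> i u; exact: F0.
- by move=> i; exact: Fc.
- by move=> i; rewrite leqNgt ltn_ord.
Qed.

End ProductExpectation.

(** * Measurability of inverses and square roots *)

Section MeasurableReal.
Set Implicit Arguments. Unset Strict Implicit.
Context {R : realType} {d : measure_display} {T : measurableType d}.

Lemma measurable_fun_invr (f : T -> R) : (forall x, 0 <= f x) ->
  measurable_fun setT f -> measurable_fun setT (fun x => (f x)^-1).
Proof.
move=> f0 mf; under eq_fun do rewrite -powR_inv1//.
exact: (measurableT_comp (measurable_powR _)).
Qed.

Lemma measurable_fun_sqrtr (f : T -> R) : (forall x, 0 <= f x) ->
  measurable_fun setT f -> measurable_fun setT (fun x => Num.sqrt (f x)).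
Proof.
move=> f0 mf; under eq_fun do rewrite -powR12_sqrt//.
exact: (measurableT_comp (measurable_powR _)).
Qed.

End MeasurableReal.

(** * The L1 distance between low-rank models *)

Section L1Distance.
Set Implicit Arguments. Unset Strict Implicit.
Context {R : realType} {dS : measure_display} {S : measurableType dS} {A : finType}.
Variable (lam : {measure set S -> \bar R}).

Lemma lowrank_density_measurable_pair (d : nat) (mu : S -> 'I_d -> R)
    (phi : S -> A -> 'I_d -> R) a : lowrank_model lam mu phi ->
  measurable_fun setT (fun u : S * S => lowrank_density mu phi u.1 a u.2).
Proof.
move=> M; apply: measurable_sum => i; apply: measurable_funM.
  have m : measurable_fun setT (mu^~ i).
    by apply/measurable_EFinP; case/integrableP : (lowrank_integrable M i).
  exact: (measurableT_comp m).
have [m _] := lowrank_bmeas M a i.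
exact: (measurableT_comp m).
Qed.

Section Dominating.
Variables (d : nat) (mu mu' : S -> 'I_d -> R).
Hypotheses (imu : forall i, lam.-integrable setT (EFin \o mu^~ i))
  (imu' : forall i, lam.-integrable setT (EFin \o mu'^~ i)).

(** Integrable, and zero only where the transition densities of both models vanish. Dividing a
    density by it is therefore harmless, including where the quotient takes the default value
    zero. *)
Definition domin (s : S) : R := \sum_i (`|mu s i| + `|mu' s i|).

Lemma domin_ge0 s : 0 <= domin s.
Proof. by apply: sumr_ge0 => i _; rewrite addr_ge0. Qed.

Let mmu i : measurable_fun setT (mu^~ i).
Proof. by apply/measurable_EFinP; case/integrableP : (imu i). Qed.

Let mmu' i : measurable_fun setT (mu'^~ i).
Proof. by apply/measurable_EFinP; case/integrableP : (imu' i). Qed.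

Lemma measurable_domin : measurable_fun setT domin.
Proof.
apply: measurable_sum => i; apply: measurable_funD; exact: measurableT_comp.
Qed.

Lemma domin_lty : (\int[lam]_s (domin s)%:E < +oo)%E.
Proof.
under eq_integral do rewrite -sumEFin.
rewrite ge0_integral_sum//; last first.
  move=> i; apply/measurable_EFinP; apply: measurable_funD; exact: measurableT_comp.
apply: lte_sum_pinfty => i _; under eq_integral do rewrite EFinD.
rewrite ge0_integralD//; last 2 first.
- by apply/measurable_EFinP; exact: measurableT_comp.
- by apply/measurable_EFinP; exact: measurableT_comp.
by apply: lte_add_pinfty; [case/integrableP : (imu i)|case/integrableP : (imu' i)].
Qed.

Lemma domin_eq0 s : domin s = 0 ->
  forall x : 'I_d -> R, dotv (mu s) x = 0 /\ dotv (mu' s) x = 0.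
Proof.
move=> /eqP; rewrite psumr_eq0 => [|i _]; last by rewrite addr_ge0.
move=> /allP z x.
have {}z i : mu s i = 0 /\ mu' s i = 0.
  have := z i (mem_index_enum i).
  by rewrite implyTb paddr_eq0// !normr_eq0 => /andP[/eqP -> /eqP ->].
by split; apply: big1 => i _; have [e1 e2] := z i; rewrite ?e1 ?e2 mul0r.
Qed.

Definition domin_measure := dens_measure domin_ge0 measurable_domin domin_lty.

End Dominating.

Section TwoModels.
Context {d : nat} {mu mu' : S -> 'I_d -> R} {phi phi' : S -> A -> 'I_d -> R}.
Hypotheses (M : lowrank_model lam mu phi) (M' : lowrank_model lam mu' phi').
Let P := lowrank_density mu phi.
Let Q := lowrank_density mu' phi'.

Let iP s a := lowrank_density_integrable M s a.
Let iQ s a := lowrank_density_integrable M' s a.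

Let iPQ s a : lam.-integrable setT (EFin \o (fun s' => `|P s a s' - Q s a s'|)).
Proof. by have := integrable_abse (integrableB measurableT (iP s a) (iQ s a)). Qed.

Lemma l1dist_le2 s a : l1dist lam P Q s a <= 2.
Proof.
apply: (@le_trans _ _ (Rintegral lam setT (fun s' => P s a s' + Q s a s'))).
  apply: le_Rintegral => //; first by have := integrableD measurableT (iP s a) (iQ s a).
  move=> s' _; have p0 : 0 <= P s a s' := lowrank_ge0 M s a s'.
  have q0 : 0 <= Q s a s' := lowrank_ge0 M' s a s'.
  by rewrite ler_norml; apply/andP; split; lra.
rewrite RintegralD//; try exact: iP; try exact: iQ.
by rewrite /Rintegral (lowrank_int1 M) (lowrank_int1 M') /=; lra.
Qed.

(* [lam] need not be sigma-finite, so Tonelli is applied to the finite measure with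
   density [domin], which carries both transition densities. *)
Lemma l1dist_bmeas a : bmeas (fun s => l1dist lam P Q s a).
Proof.
split; last first.
  exists 2 => s; rewrite ger0_norm ?l1dist_le2//; exact: Rintegral_ge0.
have imu := lowrank_integrable M; have imu' := lowrank_integrable M'.
pose g := domin mu mu'.
pose f (u : S * S) : \bar R := (`|P u.1 a u.2 - Q u.1 a u.2| / g u.2)%:E.
have g0 s : 0 <= g s by exact: domin_ge0.
have mg : measurable_fun setT g by exact: measurable_domin.
have f0 u : (0 <= f u)%E by rewrite lee_fin divr_ge0.
have mf : measurable_fun setT f.
  apply/measurable_EFinP; apply: measurable_funM.
    apply: measurableT_comp => //; apply: measurable_funB;
      exact: lowrank_density_measurable_pair.
  by apply: measurable_fun_invr => //; exact: measurableT_comp.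
have fE s : (\int[lam]_s' (`|P s a s' - Q s a s'|)%:E =
    fubini_F (domin_measure imu imu') f s)%E.
  rewrite /fubini_F integral_dens_measure//; last exact: measurableT_comp.
  apply: eq_integral => s' _; rewrite /f/= -EFinM -/(g s').
  have [z|nz] := eqVneq (g s') 0; last by rewrite divfK.
  have [e1 _] := domin_eq0 z (phi s a); have [_ e2] := domin_eq0 z (phi' s a).
  by rewrite z mulr0 /P /Q /lowrank_density e1 e2 subrr normr0.
rewrite /l1dist /Rintegral; under eq_fun do rewrite fE.
apply: (measurableT_comp (fine_measurable measurableT)).
exact: measurable_fun_fubini_tonelli_F.
Qed.

Lemma l1distC s a : l1dist lam P Q s a = l1dist lam Q P s a.
Proof. by apply: eq_Rintegral => s' _; rewrite distrC. Qed.

End TwoModels.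

Lemma l1distxx (P : S -> A -> S -> R) s a : l1dist lam P P s a = 0.
Proof.
rewrite /l1dist; under eq_Rintegral do rewrite subrr normr0.
by rewrite Rintegral_cst// mul0r.
Qed.

Lemma l1dist_triangle (d : nat) (mu1 mu2 mu3 : S -> 'I_d -> R)
    (phi1 phi2 phi3 : S -> A -> 'I_d -> R) s a :
  lowrank_model lam mu1 phi1 -> lowrank_model lam mu2 phi2 ->
  lowrank_model lam mu3 phi3 ->
  l1dist lam (lowrank_density mu1 phi1) (lowrank_density mu3 phi3) s a <=
  l1dist lam (lowrank_density mu1 phi1) (lowrank_density mu2 phi2) s a +
  l1dist lam (lowrank_density mu2 phi2) (lowrank_density mu3 phi3) s a.
Proof.
move=> M1 M2 M3.
have i1 := lowrank_density_integrable M1 s a.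
have i2 := lowrank_density_integrable M2 s a.
have i3 := lowrank_density_integrable M3 s a.
have iB P Q : lam.-integrable setT (EFin \o P) -> lam.-integrable setT (EFin \o Q) ->
    lam.-integrable setT (EFin \o (fun s' : S => `|P s' - Q s'|)).
  by move=> iP iQ; have := integrable_abse (integrableB measurableT iP iQ).
rewrite -RintegralD//; try exact: iB.
apply: le_Rintegral => //; first exact: iB.
  by have := integrableD measurableT (iB _ _ i1 i2) (iB _ _ i2 i3).
by move=> s' _; exact: ler_distD.
Qed.

End L1Distance.

(** * The joint law of the samples *)

Section SampleLaw.
Set Implicit Arguments. Unset Strict Implicit.
Context {R : realType} {dS : measure_display} {S : measurableType dS} {A : finType}.
Variables (lam : {measure set S -> \bar R}) (d : nat).
Variables (mu : S -> 'I_d -> R) (phi : S -> A -> 'I_d -> R).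
Hypothesis M : lowrank_model lam mu phi.
Let P := lowrank_density mu phi.
Variables (rho : S -> R) (pib : S -> A -> R).
Hypotheses (mpib : markov_policy (fun _ => pib)) (rho0 : forall s, 0 <= rho s)
  (mrho : measurable_fun setT rho) (rho1 : (\int[lam]_s (rho s)%:E = 1)%E).

Let P0 s a s' : 0 <= P s a s'.
Proof. exact: (lowrank_ge0 M). Qed.

Let mP a : measurable_fun setT (fun u : S * S => P u.1 a u.2).
Proof. exact: (lowrank_density_measurable_pair a M). Qed.

Let pib0 s a : 0 <= pib s a.
Proof. by case: mpib => p0 _ _; exact: (p0 0%N). Qed.

Let mpib' a : measurable_fun setT (fun s => pib s a).
Proof. by case: mpib => _ _ m; exact: (m 0%N). Qed.

Let rho_lty : (\int[lam]_s (rho s)%:E < +oo)%E.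
Proof. by rewrite rho1 ltry. Qed.

Let imu := lowrank_integrable M.
Let g := domin mu mu.
Let Lam1 : {finite_measure set S -> \bar R} := dens_measure rho0 mrho rho_lty.
Let Lam2 : {finite_measure set S -> \bar R} := domin_measure imu imu.

Let q a (u : S * S) := pib u.1 a * (P u.1 a u.2 / g u.2).

Let q0 a u : 0 <= q a u.
Proof. by rewrite mulr_ge0// divr_ge0//; exact: domin_ge0. Qed.

Let mq a : measurable_fun setT (q a).
Proof.
apply: measurable_funM; first exact: (measurableT_comp (mpib' a)).
apply: measurable_funM => //; apply: measurable_fun_invr => [u|].
  exact: domin_ge0.
by apply: (measurableT_comp (measurable_domin imu imu)).
Qed.

Let innerE a (F : S * S -> R) s : measurable_fun setT F -> (forall u, 0 <= F u) ->
  (\int[lam]_s' (F (s, s') * P s a s')%:E =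
   fubini_F Lam2 (fun u => (F u * (P u.1 a u.2 / g u.2))%:E) s)%E.
Proof.
move=> mF F0; rewrite /fubini_F integral_dens_measure; last 2 first.
- apply/measurable_EFinP; apply: measurable_funM; first exact: measurableT_comp.
  apply: measurable_funM; first exact: (lowrank_density_measurable M).
  apply: measurable_fun_invr; first exact: domin_ge0.
  exact: measurable_domin.
- by move=> s'; rewrite lee_fin mulr_ge0// divr_ge0//; exact: domin_ge0.
apply: eq_integral => s' _; rewrite -EFinM /= -/(g s'); congr (_%:E).
have [z|nz] := eqVneq (g s') 0; last by field.
have [e1 _] := domin_eq0 z (phi s a).
by rewrite z mulr0 [P s a s']e1 !mulr0.
Qed.

Let measurable_inner a (F : S * S -> R) :
  measurable_fun setT F -> (forall u, 0 <= F u) ->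
  measurable_fun setT (fun s => \int[lam]_s' (F (s, s') * P s a s')%:E)%E.
Proof.
move=> mF F0; under eq_fun do rewrite innerE//.
apply: measurable_fun_fubini_tonelli_F => [|u]; last first.
  by rewrite lee_fin mulr_ge0// divr_ge0//; exact: domin_ge0.
apply/measurable_EFinP; apply: measurable_funM => //; apply: measurable_funM => //.
apply: measurable_fun_invr => [u|]; first exact: domin_ge0.
by apply: (measurableT_comp (measurable_domin imu imu)).
Qed.

(* [q] is a density with respect to finite measures, which makes Tonelli available;
   the right-hand side is the joint law of [(s, s')] on the event [a]. *)
Let integral_q a (F : S * S -> R) : measurable_fun setT F -> (forall u, 0 <= F u) ->
  (\int[(Lam1 \x Lam2)%E]_u (F u * q a u)%:E =
   \int[lam]_s ((rho s * pib s a)%:E * \int[lam]_s' (F (s, s') * P s a s')%:E))%E.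
Proof.
move=> mF F0.
have mFq : measurable_fun setT (fun u => (F u * q a u)%:E).
  by apply/measurable_EFinP; exact: measurable_funM.
have Fq0 u : (0 <= (F u * q a u)%:E)%E by rewrite lee_fin mulr_ge0.
rewrite fubini_tonelli1// integral_dens_measure; last 2 first.
- exact: measurable_fun_fubini_tonelli_F.
- by move=> s; apply: integral_ge0.
apply: eq_integral => s _; rewrite /fubini_F.
have k0 s' : (0 <= (F (s, s') * (P s a s' / g s'))%:E)%E.
  by rewrite lee_fin mulr_ge0// divr_ge0//; exact: domin_ge0.
rewrite innerE// /fubini_F EFinM -muleA -ge0_integralZl_EFin//; last first.
  apply/measurable_EFinP; apply: measurable_funM; first exact: measurableT_comp.
  apply: measurable_funM; first exact: (lowrank_density_measurable M).
  apply: measurable_fun_invr; first exact: domin_ge0.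
  exact: measurable_domin.
rewrite muleC; congr (_ * _)%E; apply: eq_integral => s' _.
by rewrite -EFinM /q /=; congr (_%:E); ring.
Qed.

Let q_lty a : (\int[(Lam1 \x Lam2)%E]_u (q a u)%:E < +oo)%E.
Proof.
rewrite (eq_integral (fun u => ((fun=> 1) u * q a u)%:E)) => [|u _]; last by rewrite mul1r.
rewrite integral_q//; apply: le_lt_trans rho_lty; apply: ge0_le_integral => //.
- move=> s _; rewrite mule_ge0 ?lee_fin ?mulr_ge0//.
  by apply: integral_ge0 => s' _; rewrite lee_fin mul1r.
- apply: emeasurable_funM; first by apply/measurable_EFinP; exact: measurable_funM.
  rewrite (_ : (fun s => _) = cst 1%E)//; apply/funext => s.
  by under eq_integral do rewrite /= mul1r; exact: (lowrank_int1 M).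
- exact/measurable_EFinP.
- move=> s _; under eq_integral do rewrite /= mul1r.
  rewrite (lowrank_int1 M) mule1 lee_fin ler_piMr//.
  case: mpib => _ p1 _; rewrite -(p1 0%N s) (bigD1 a)//= lerDl sumr_ge0//.
Qed.

Let nu a : {finite_measure set (S * S)%type -> \bar R} :=
  dens_measure (q0 a) (mq a) (q_lty a).

Let integral_nu a (F : S * S -> R) : measurable_fun setT F -> (forall u, 0 <= F u) ->
  (\int[nu a]_u (F u)%:E =
   \int[lam]_s ((rho s * pib s a)%:E * \int[lam]_s' (F (s, s') * P s a s')%:E))%E.
Proof.
move=> mF F0; rewrite integral_dens_measure//.
- by rewrite -integral_q//; apply: eq_integral => u _; rewrite EFinM.
- exact/measurable_EFinP.
Qed.

Let nu_rectangle a (B1 B2 : set S) : measurable B1 -> measurable B2 ->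
  fine (nu a (B1 `*` B2)) =
  Rintegral lam B1 (fun s => rho s * pib s a * Rintegral lam B2 (fun s' => P s a s')).
Proof.
move=> mB1 mB2; rewrite /Rintegral; congr fine.
have mB := measurableX mB1 mB2.
have := integral_indic (nu a) measurableT mB; rewrite setIT => <-.
rewrite integral_nu ?measurable_indic// [RHS]integral_mkcond.
apply: eq_integral => s _; rewrite patchE.
have iB2 : (\int[lam]_(s' in B2) (P s a s')%:E \is a fin_num)%E.
  apply: integrable_fin_num => //; apply: integrableS measurableT mB2 _ _ => //.
  exact: (lowrank_density_integrable M).
case: ifPn => [sB|sB].
  rewrite [RHS]EFinM fineK//; congr (_ * _)%E; rewrite [RHS]integral_mkcond.
  apply: eq_integral => s' _; rewrite patchE indicE in_setX sB /=.
  by case: ifP => _; rewrite ?mul1r ?mul0r.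
rewrite [X in (_ * X)%E]integral0_eq ?mule0// => s' _.
by rewrite indicE in_setX (negPf sB) mul0r.
Qed.

Variables (n : nat) (dO : measure_display) (Omega : measurableType dO)
  (Pr : probability Omega R).
Variables (Xs : 'I_n -> Omega -> S) (Xa : 'I_n -> Omega -> A) (Xs' : 'I_n -> Omega -> S).
Hypotheses (mXs : forall i, measurable_fun setT (Xs i))
  (mXs' : forall i, measurable_fun setT (Xs' i))
  (mXa : forall i a, measurable [set w | Xa i w = a]).
Hypothesis sample_law : forall (B1 B2 : 'I_n -> set S) (al : 'I_n -> A),
  (forall i, measurable (B1 i)) -> (forall i, measurable (B2 i)) ->
  Pr (\bigcap_(i in [set: 'I_n])
        [set w | B1 i (Xs i w) /\ Xa i w = al i /\ B2 i (Xs' i w)])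
  = (\prod_(i < n) Rintegral lam (B1 i) (fun s => rho s * pib s (al i) *
         Rintegral lam (B2 i) (fun s' => dotv (mu s') (phi s (al i)))))%:E.

Let X i w := (Xs i w, Xs' i w).

Let mX i : measurable_fun setT (X i).
Proof. exact: measurable_fun_pair. Qed.

Let sample_prod_expectation (F : 'I_n -> S * S -> A -> R) (c : 'I_n -> A -> R) :
  (forall i a, measurable_fun setT (fun u => F i u a)) ->
  (forall i u a, 0 <= F i u a) ->
  (forall i a, \int[lam]_s ((rho s * pib s a)%:E *
     \int[lam]_s' (F i (s, s') a * P s a s')%:E) = (c i a)%:E)%E ->
  (\int[Pr]_w (\prod_(i < n) F i (X i w) (Xa i w))%:E =
   (\prod_(i < n) \sum_a c i a)%:E)%E.
Proof.
move=> mF F0 Fc; apply: (prod_expectation (nu := nu)) => //.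
- move=> B1 B2 al mB1 mB2; rewrite /X/= sample_law//; congr (_%:E).
  by apply: eq_bigr => i _; rewrite nu_rectangle.
- by move=> i a; rewrite integral_nu.
Qed.

Let weight_integrable a (b : S -> R) : bmeas b ->
  lam.-integrable setT (EFin \o (fun s => rho s * pib s a * b s)).
Proof.
move=> bb; apply: integrableM_bmeas => //; apply: integrableM_bmeas; last first.
  exact: (policy_bmeas mpib 0 a).
apply/integrableP; split; first exact/measurable_EFinP.
by under eq_integral do rewrite /= ger0_norm//.
Qed.

(** Independence gives the [n]-th power of a one-sample expectation, which conditioning on [(s, a)]
    bounds by [rho_exp lam rho pib b]. Boundedness of [b] also supplies the finiteness that the
    product formula requires. *)
Lemma sample_prod_le1 (F : S * S -> A -> R) (b : S -> A -> R) :
  (forall a, measurable_fun setT (fun u => F u a)) -> (forall u a, 0 <= F u a) ->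
  (forall a, bmeas (fun s => b s a)) ->
  (forall s a, \int[lam]_s' (F (s, s') a * P s a s')%:E <= (b s a)%:E)%E ->
  rho_exp lam rho pib b <= 1 ->
  (\int[Pr]_w (\prod_(i < n) F (Xs i w, Xs' i w) (Xa i w))%:E <= 1)%E.
Proof.
move=> mF F0 bb Fb b1.
pose I a := (\int[lam]_s ((rho s * pib s a)%:E *
  \int[lam]_s' (F (s, s') a * P s a s')%:E))%E.
have in0 a s : (0 <= \int[lam]_s' (F (s, s') a * P s a s')%:E)%E.
  by apply: integral_ge0 => s' _; rewrite lee_fin mulr_ge0.
have I0 a : (0 <= I a)%E.
  by apply: integral_ge0 => s _; rewrite mule_ge0// lee_fin mulr_ge0.
have w0 s a : 0 <= rho s * pib s a by rewrite mulr_ge0.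
have b0 s a : 0 <= b s a by rewrite -lee_fin; apply: le_trans (Fb s a).
have iw a := weight_integrable a (bb a).
have Ib a : (I a <= (Rintegral lam setT (fun s => rho s * pib s a * b s a))%:E)%E.
  rewrite /I /Rintegral fineK; last by exact: integrable_fin_num (iw a).
  apply: ge0_le_integral => //.
  - by move=> s _; rewrite mule_ge0// lee_fin.
  - apply: emeasurable_funM; last exact: (@measurable_inner a (F^~ a) (mF a) (F0^~ a)).
    by apply/measurable_EFinP; exact: measurable_funM.
  - by case/integrableP : (iw a).
  - by move=> s _; rewrite [leRHS]EFinM lee_wpmul2l// lee_fin.
have Ifin a : I a = (fine (I a))%:E.
  by rewrite fineK// ge0_fin_numE// (le_lt_trans (Ib a))// ltry.
rewrite (@sample_prod_expectation (fun=> F) (fun _ a => fine (I a)))//.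
have s0 : 0 <= \sum_a fine (I a) by apply: sumr_ge0 => a _; rewrite fine_ge0.
rewrite prodr_const card_ord lee_fin exprn_ile1//.
apply: le_trans b1; rewrite /rho_exp.
under eq_Rintegral => s _.
  rewrite mulr_sumr; under eq_bigr do rewrite mulrA -[_ * _ * _]mul1r.
  over.
rewrite (Rintegral_sumZ _ (fun=> 1) iw); apply: ler_sum => a _.
by rewrite mul1r -lee_fin -Ifin.
Qed.

(** Almost surely no likelihood ratio has a zero denominator, so the true model has a finite
    log-likelihood. The product formula is applied with an indicator at [i] and constants
    elsewhere. *)
Lemma sample_density_eq0_null i : Pr [set w | P (Xs i w) (Xa i w) (Xs' i w) = 0] = 0%E.
Proof.
pose Z a := [set u : S * S | P u.1 a u.2 = 0].
have mZ a : measurable (Z a).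
  by rewrite -[Z a]setTI; exact: (mP a measurableT (measurable_set1 0)).
pose F j (u : S * S) a : R := if j == i then \1_(Z a) u else 1.
have mF j a : measurable_fun setT (fun u => F j u a).
  by rewrite /F; case: eqP => _ //; exact: measurable_indic.
have F0 j u a : 0 <= F j u a by rewrite /F; case: eqP.
pose c j a := if j == i then 0 else Rintegral lam setT (fun s => rho s * pib s a * 1).
have := @sample_prod_expectation F c mF F0; rewrite (bigD1 i)//=.
rewrite [X in (X * _)%:E]big1 ?mul0r => [|a _]; last by rewrite /c eqxx.
move=> h; have {h} : (\int[Pr]_w (\1_[set w | P (Xs i w) (Xa i w) (Xs' i w) = 0] w)%:E = 0)%E.
  rewrite -[RHS]/(0%:E) -h => [|j a].
  - apply: eq_integral => w _; rewrite (bigD1 i)//= big1 ?mulr1.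
      by rewrite /F eqxx !indicE; congr (_%:R)%:E; apply/idP/idP; rewrite !inE.
    by move=> j ji; rewrite /F (negPf ji).
  rewrite /F /c; case: eqP => _.
    apply: integral0_eq => s _; rewrite integral0_eq ?mule0// => s' _.
    rewrite indicE; case: (boolP (_ \in _)); rewrite ?mul0r// inE /Z /= => ->.
    by rewrite mulr0.
  have i1 := weight_integrable a (alg_cst bmeas_algebra (1 : R)).
  rewrite /Rintegral fineK; last by exact: integrable_fin_num i1.
  apply: eq_integral => s _.
  under eq_integral do rewrite mul1r.
  by rewrite (lowrank_int1 M) EFinM.
rewrite integral_indic// ?setIT//.
have -> : [set w | P (Xs i w) (Xa i w) (Xs' i w) = 0] =
    \bigcup_(a in [set: A]) ([set w | Xa i w = a] `&` X i @^-1` Z a).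
  by apply/seteqP; split => [w h|w [a _ [/= <-]]]; [exists (Xa i w)|].
apply: fin_bigcup_measurable; first exact: finite_finset.
move=> a _; apply: measurableI => //; rewrite -[X in measurable X]setTI.
exact: (mX i measurableT).
Qed.

End SampleLaw.

(** * Markov's inequality *)

Section Markov.
Set Implicit Arguments. Unset Strict Implicit.
Context {R : realType} {d : measure_display} {T : measurableType d}.

Lemma markov_le1 (Pr : probability T R) (f : T -> R) (K : R) :
  measurable_fun setT f -> (forall x, 0 <= f x) -> 0 < K ->
  (\int[Pr]_x (f x)%:E <= 1)%E ->
  measurable [set x | K <= f x] /\ (Pr [set x | (K <= f x)%R] <= (K^-1)%:E)%E.
Proof.
move=> mf f0 K0 f1.
have mE : measurable [set x | K <= f x].
  rewrite (_ : [set x | _] = f @^-1` `[K, +oo[%classic).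
    by rewrite -[X in measurable X]setTI; exact: mf.
  by apply/seteqP; split => x /=; rewrite in_itv/= andbT.
split=> //; suff : (K%:E * Pr [set x | (K <= f x)%R] <= 1)%E.
  rewrite -[Pr _]fineK ?fin_num_measure// -EFinM !lee_fin => h.
  by rewrite -[K^-1]mulr1 ler_pdivlMl.
apply: le_trans f1; rewrite -(setIT [set x | _]) -integral_indic//.
rewrite -ge0_integralZl//; last 2 first.
- by apply/measurable_EFinP; exact: measurable_indic.
- by rewrite lee_fin ltW.
apply: ge0_le_integral => //.
- by move=> x _; rewrite mule_ge0// lee_fin// ltW.
- by apply/measurable_EFinP; apply: measurable_funM => //; exact: measurable_indic.
- exact/measurable_EFinP.
move=> x _; rewrite -EFinM lee_fin indicE.
by case: (boolP (x \in _)); rewrite ?mulr0// mulr1 inE.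
Qed.

End Markov.

(** * Elementary inequalities for likelihood ratios *)

Section RealInequalities.
Set Implicit Arguments. Unset Strict Implicit.
Context {R : realType}.

(* Linear in [x] and [`|p - q|], so that integrating it bounds the Hellinger affinity by
   [1 - l ^+ 2 / 8] when [l] is the integral of [`|p - q|]. *)
Lemma affinity_pointwise (p q x l : R) : 0 <= p -> 0 <= q -> 0 <= x -> x ^+ 2 <= p * q ->
  0 <= l -> x <= (2^-1 + l ^+ 2 / 16) * (p + q) - l / 4 * `|p - q|.
Proof.
move=> p0 q0 x0 xpq l0.
set D := `|p - q|; have D2 : D ^+ 2 = (p - q) ^+ 2 by rewrite /D real_normK ?num_real.
have D0 : 0 <= D by exact: normr_ge0.
have m2x : 2 * x <= p + q.
  rewrite leNgt; apply/negP => h; have := sqr_ge0 (p - q); nra.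
have [m0|mn0] := eqVneq (p + q) 0.
  have pz : p = 0 by lra.
  have qz : q = 0 by lra.
  have -> : D = 0 by rewrite /D pz qz subrr normr0.
  by rewrite m0 !mulr0; lra.
have m0 : 0 < p + q by rewrite lt_def mn0 addr_ge0.
rewrite -subr_ge0 -(pmulr_rge0 _ m0).
(* Completing the square in [D]. As [x^2 <= p q], the remaining summand is at least
   [(p + q - 2 x)^2 / 4]. *)
have -> : (p + q) * ((2^-1 + l ^+ 2 / 16) * (p + q) - l / 4 * D - x) =
    (l * (p + q) / 4 - D / 2) ^+ 2 + ((p + q) * ((p + q) / 2 - x) - D ^+ 2 / 4) by field.
apply: addr_ge0; first exact: sqr_ge0.
rewrite D2; have := sqr_ge0 (p + q - 2 * x); nra.
Qed.

(** From [1 + x <= exp x], since [(1 + x) (1 - x / 2) >= 1] on the unit interval. *)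
Lemma expRN_le_chord (x : R) : 0 <= x <= 1 -> expR (- x) <= 1 - x / 2.
Proof.
move=> /andP[x0 x1]; have h := expR_ge1Dx x.
have e0 := expR_gt0 x; rewrite expRN -[leLHS]mul1r ler_pdivrMr//; nra.
Qed.

Lemma onesub_mul_expR_le1 (x : R) : (1 - x) * expR x <= 1.
Proof.
have := expR_ge1Dx (- x) => h; rewrite -ler_pdivlMr ?expR_gt0// mul1r -expRN.
exact: h.
Qed.

Lemma prod_expR (n : nat) (f : 'I_n -> R) :
  \prod_(i < n) expR (f i) = expR (\sum_(i < n) f i).
Proof. by rewrite expR_sum. Qed.

Lemma elog_sum_le (n : nat) (p q : 'I_n -> R) :
  (forall i, 0 < p i) -> (forall i, 0 <= q i) ->
  (\sum_(i < n) elog (p i) <= \sum_(i < n) elog (q i))%E ->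
  1 <= \prod_(i < n) Num.sqrt (q i / p i).
Proof.
move=> p0 q0.
have -> : (\sum_(i < n) elog (p i) = (\sum_(i < n) ln (p i))%:E)%E.
  by rewrite -sumEFin; apply: eq_bigr => i _; rewrite /elog p0.
(* A vanishing [q i] makes the right side [-oo], against a finite left side. *)
have [/forallP q1|] := boolP [forall i, 0 < q i]; last first.
  rewrite negb_forall => /existsP[i qi].
  rewrite (_ : (\sum_(i < n) elog (q i))%E = -oo%E)//.
  apply/eqP; rewrite esum_eqNy.
  by apply/existsP; exists i; rewrite /elog (negPf qi) eqxx.
have -> : (\sum_(i < n) elog (q i) = (\sum_(i < n) ln (q i))%:E)%E.
  by rewrite -sumEFin; apply: eq_bigr => i _; rewrite /elog q1.
rewrite lee_fin => h.
have sE i : Num.sqrt (q i / p i) = expR ((ln (q i) - ln (p i)) / 2).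
  have qp : 0 < q i / p i by rewrite divr_gt0.
  have r0 : 0 <= expR ((ln (q i) - ln (p i)) / 2) by rewrite expR_ge0.
  rewrite -[RHS]ger0_norm// -sqrtr_sqr; congr Num.sqrt.
  rewrite expr2 -expRD -splitr -ln_div ?posrE// lnK//.
under eq_bigr do rewrite sE.
rewrite prod_expR -[leLHS]expR0 ler_expR -mulr_suml sumrB; lra.
Qed.

End RealInequalities.

(** * Two statistics of mean at most one *)

Section LikelihoodRatio.
Set Implicit Arguments. Unset Strict Implicit.
Context {R : realType} {dS : measure_display} {S : measurableType dS} {A : finType}.
Variables (lam : {measure set S -> \bar R}) (d : nat).
Variables (mu mu' : S -> 'I_d -> R) (phi phi' : S -> A -> 'I_d -> R).
Hypotheses (M : lowrank_model lam mu phi) (M' : lowrank_model lam mu' phi').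
Let P := lowrank_density mu phi.
Let Q := lowrank_density mu' phi'.
Let l s a := l1dist lam Q P s a.

(** The square root is what produces a gain: the plain ratio can have mean one however far the
    models are apart, while the mean of the root is a Hellinger affinity and leaves room for the
    exponential factor. *)
Definition root_ratio (u : S * S) (a : A) : R :=
  Num.sqrt (Q u.1 a u.2 / P u.1 a u.2) * expR (l u.1 a ^+ 2 / 8).

Let P0 s a s' : 0 <= P s a s'. Proof. exact: (lowrank_ge0 M). Qed.
Let Q0 s a s' : 0 <= Q s a s'. Proof. exact: (lowrank_ge0 M'). Qed.
Let l0 s a : 0 <= l s a. Proof. exact: Rintegral_ge0. Qed.

Let ml a : measurable_fun setT (fun s => l s a).
Proof. by have [] := l1dist_bmeas M' M a. Qed.

Lemma root_ratio_ge0 u a : 0 <= root_ratio u a.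
Proof. by rewrite mulr_ge0 ?sqrtr_ge0 ?expR_ge0. Qed.

Lemma measurable_root_ratio a : measurable_fun setT (fun u => root_ratio u a).
Proof.
have mPu := lowrank_density_measurable_pair a M.
have mQu := lowrank_density_measurable_pair a M'.
apply: measurable_funM.
  apply: measurable_fun_sqrtr => [u|]; first by rewrite divr_ge0.
  by apply: measurable_funM => //; exact: measurable_fun_invr.
apply: measurableT_comp => //; apply: measurable_funM => //.
apply: measurable_funX; exact: (measurableT_comp (ml a)).
Qed.

Lemma integral_root_ratio_le1 s a :
  (\int[lam]_s' (root_ratio (s, s') a * P s a s')%:E <= 1)%E.
Proof.
set y := l s a; set e := expR (y ^+ 2 / 8); have y0 : 0 <= y by exact: l0.
pose ub s' := e * ((2^-1 + y ^+ 2 / 16) * (P s a s' + Q s a s')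
   - y / 4 * `|Q s a s' - P s a s'|).
have iP := lowrank_density_integrable M s a.
have iQ := lowrank_density_integrable M' s a.
have iPQ : lam.-integrable setT (EFin \o (fun s' => `|Q s a s' - P s a s'|)).
  by have := integrable_abse (integrableB measurableT iQ iP).
have iD : lam.-integrable setT (EFin \o (fun s' => P s a s' + Q s a s')).
  by have := integrableD measurableT iP iQ.
have i1 : lam.-integrable setT (EFin \o
    (fun s' => (2^-1 + y ^+ 2 / 16) * (P s a s' + Q s a s'))).
  by have := integrableZl measurableT (2^-1 + y ^+ 2 / 16) iD.
have i2 : lam.-integrable setT (EFin \o (fun s' => y / 4 * `|Q s a s' - P s a s'|)).
  by have := integrableZl measurableT (y / 4) iPQ.
have i3 : lam.-integrable setT (EFin \o (fun s' =>
    (2^-1 + y ^+ 2 / 16) * (P s a s' + Q s a s') - y / 4 * `|Q s a s' - P s a s'|)).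
  by have := integrableB measurableT i1 i2.
have iub : lam.-integrable setT (EFin \o ub) by have := integrableZl measurableT e i3.
have e0 : 0 <= e by exact: expR_ge0.
have le_ub s' : root_ratio (s, s') a * P s a s' <= ub s'.
  rewrite /root_ratio /= -/y -/e /ub mulrAC [leRHS]mulrC ler_wpM2r//.
  rewrite distrC; apply: affinity_pointwise => //; first by rewrite mulr_ge0 ?sqrtr_ge0.
  rewrite exprMn sqr_sqrtr ?divr_ge0//.
  have [->|pn0] := eqVneq (P s a s') 0; first by rewrite expr0n mulr0 mul0r.
  by rewrite le_eqVlt; apply/orP; left; apply/eqP; field.
(* The two unit masses contribute [1 + y^2 / 8] and the L1 term [- y^2 / 4], because the slope was
   chosen at the distance [y] itself. *)
have Rub : Rintegral lam setT ub = e * (1 - y ^+ 2 / 8).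
  have P1 : Rintegral lam setT (P s a) = 1 by rewrite /Rintegral (lowrank_int1 M).
  have Q1 : Rintegral lam setT (Q s a) = 1 by rewrite /Rintegral (lowrank_int1 M').
  rewrite RintegralZl// RintegralB// !RintegralZl// RintegralD//.
  by rewrite -/(l1dist lam Q P s a) -/(l s a) -/y P1 Q1; field.
apply: (@le_trans _ _ (\int[lam]_s' (ub s')%:E)%E).
  apply: ge0_le_integral => //.
  - by move=> s' _; rewrite lee_fin mulr_ge0// root_ratio_ge0.
  - apply/measurable_EFinP; apply: measurable_funM.
      exact: (measurableT_comp (measurable_root_ratio a)).
    exact: (lowrank_density_measurable M).
  - by case/integrableP : iub.
  - by move=> s' _; rewrite lee_fin.
rewrite -[leLHS]fineK; last exact: integrable_fin_num iub.
by rewrite lee_fin -/(Rintegral lam setT ub) Rub mulrC onesub_mul_expR_le1.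
Qed.

Variables (rho : S -> R) (pib : S -> A -> R).
Hypotheses (mpib : markov_policy (fun _ => pib)) (rho0 : forall s, 0 <= rho s)
  (mrho : measurable_fun setT rho) (rho1 : (\int[lam]_s (rho s)%:E = 1)%E).

Let EL := rho_expectation mpib rho0 mrho rho1.

(** The L1 distance is at most 2; dividing its square by 4 lands in the unit interval, where the
    chord bound for the exponential holds. *)
Definition quarter_sqr s a : R := l s a ^+ 2 / 4.

Lemma quarter_sqr01 s a : 0 <= quarter_sqr s a <= 1.
Proof.
have := l1dist_le2 M' M s a; rewrite -/(l s a) => l2; have := l0 s a.
by rewrite /quarter_sqr => ?; apply/andP; split; nra.
Qed.

Lemma quarter_sqr_bmeas a : bmeas (fun s => quarter_sqr s a).
Proof.
apply: (alg_mul bmeas_algebra); last exact: (alg_cst bmeas_algebra).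
by apply: (alg_sqr bmeas_algebra); exact: l1dist_bmeas.
Qed.

Let Eg := rho_exp lam rho pib quarter_sqr.

Definition tilted_sqr (s : S) (a : A) : R := expR (- quarter_sqr s a) * expR (Eg / 2).

Lemma tilted_sqr_ge0 s a : 0 <= tilted_sqr s a.
Proof. by rewrite mulr_ge0 ?expR_ge0. Qed.

Lemma tilted_sqr_bmeas a : bmeas (fun s => tilted_sqr s a).
Proof.
apply: (alg_mul bmeas_algebra); last exact: (alg_cst bmeas_algebra).
have [mq _] := quarter_sqr_bmeas a; split.
  by apply: measurableT_comp => //; exact: measurableT_comp.
exists 1 => s; rewrite ger0_norm ?expR_ge0// -expR0 ler_expR oppr_le0.
by have /andP[] := quarter_sqr01 s a.
Qed.

(** The chord bound is affine, so it integrates to [1 - Eg / 2], which [expR (Eg / 2)] absorbs. *)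
Lemma rho_exp_tilted_le1 : rho_exp lam rho pib tilted_sqr <= 1.
Proof.
have bq : sabmeas (fun u : S * A => quarter_sqr u.1 u.2) by exact: quarter_sqr_bmeas.
pose b (u : S * A) := expR (Eg / 2) * (1 - 2^-1 * quarter_sqr u.1 u.2).
have b1 : sabmeas (fun u : S * A => 1 - 2^-1 * quarter_sqr u.1 u.2).
  apply: (alg_sub sabmeas_algebra); first exact: (alg_cst sabmeas_algebra).
  exact: (alg_scale sabmeas_algebra).
apply: (@le_trans _ _ (rho_exp lam rho pib (fun s a => b (s, a)))).
  apply: (expect_le EL (f := fun u => tilted_sqr u.1 u.2) (g := b)).
  - exact: tilted_sqr_bmeas.
  - exact: (alg_scale sabmeas_algebra).
  - move=> u; rewrite /b /tilted_sqr mulrC ler_wpM2l ?expR_ge0// [2^-1 * _]mulrC.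
    exact/expRN_le_chord/quarter_sqr01.
have /= -> := expectZ EL (expR (Eg / 2)) b1.
have b2 := alg_scale sabmeas_algebra 2^-1 bq.
have /= -> := expectB EL (alg_cst sabmeas_algebra 1) b2.
have /= -> := expect_cst EL 1; have /= -> := expectZ EL 2^-1 bq.
by rewrite mulrC (mulrC 2^-1) onesub_mul_expR_le1.
Qed.

End LikelihoodRatio.

(** * Union bound and measurability with a finite argument *)

Section UnionBound.
Set Implicit Arguments. Unset Strict Implicit.
Context {R : realType} {d : measure_display} {T : measurableType d}.

Lemma measure_bigsetU_le (m : {measure set T -> \bar R}) (I : Type) (s : seq I)
    (p : pred I) (F : I -> set T) : (forall i, measurable (F i)) ->
  (m (\big[setU/set0]_(i <- s | p i) F i) <= \sum_(i <- s | p i) m (F i))%E.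
Proof.
move=> mF; elim: s => [|i s IH]; first by rewrite !big_nil measure0.
rewrite !big_cons; case: ifP => // _.
have mbig : measurable (\big[setU/set0]_(i <- s | p i) F i).
  exact: bigsetU_measurable.
by apply: le_trans (measureU2 _ (mF i) mbig) _; exact: leeD2l.
Qed.

Lemma measurable_fun_finite_arg {dO : measure_display} {Omega : measurableType dO}
    {A : finType} (X : Omega -> T) (Xa : Omega -> A) (F : T -> A -> R) :
  measurable_fun setT X -> (forall a, measurable [set w | Xa w = a]) ->
  (forall a, measurable_fun setT (F^~ a)) ->
  measurable_fun setT (fun w => F (X w) (Xa w)).
Proof.
move=> mX mXa mF.
rewrite (_ : (fun w => _) = fun w => \sum_a \1_[set w | Xa w = a] w * F (X w) a).
  apply: measurable_sum => a; apply: measurable_funM; first exact: measurable_indic.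
  exact: (measurableT_comp (mF a)).
apply/funext => w; rewrite (bigD1 (Xa w))//= indicE mem_set//= mul1r.
rewrite big1 ?addr0// => a aX; rewrite indicE memNset ?mul0r//= => Xwa.
by rewrite Xwa eqxx in aX.
Qed.

End UnionBound.

(** * The high-probability event *)

Section MLEEvent.
Set Implicit Arguments. Unset Strict Implicit.
Context {R : realType} {dS : measure_display} {S : measurableType dS} {A : finType}.
Variables (lam : {measure set S -> \bar R}) (d : nat).
Variables (IPsi IPhi : finType) (mu : IPsi -> S -> 'I_d -> R)
  (phi : IPhi -> S -> A -> 'I_d -> R) (kstar : IPsi) (jstar : IPhi).
Hypothesis MM : forall k j, lowrank_model lam (mu k) (phi j).
Variables (rho : S -> R) (pib : S -> A -> R).
Hypotheses (mpib : markov_policy (fun _ => pib)) (rho0 : forall s, 0 <= rho s)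
  (mrho : measurable_fun setT rho) (rho1 : (\int[lam]_s (rho s)%:E = 1)%E).
Variables (n : nat) (dO : measure_display) (Omega : measurableType dO)
  (Pr : probability Omega R).
Variables (Xs : 'I_n -> Omega -> S) (Xa : 'I_n -> Omega -> A) (Xs' : 'I_n -> Omega -> S).
Hypotheses (mXs : forall i, measurable_fun setT (Xs i))
  (mXs' : forall i, measurable_fun setT (Xs' i))
  (mXa : forall i a, measurable [set w | Xa i w = a]).
Hypothesis sample_law : forall (B1 B2 : 'I_n -> set S) (al : 'I_n -> A),
  (forall i, measurable (B1 i)) -> (forall i, measurable (B2 i)) ->
  Pr (\bigcap_(i in [set: 'I_n])
        [set w | B1 i (Xs i w) /\ Xa i w = al i /\ B2 i (Xs' i w)])
  = (\prod_(i < n) Rintegral lam (B1 i) (fun s => rho s * pib s (al i) *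
         Rintegral lam (B2 i) (fun s' => dotv (mu kstar s') (phi jstar s (al i)))))%:E.
Variable delta : R.
Hypothesis delta01 : 0 < delta < 1.

Let Pm k j : tdens := lowrank_density (mu k) (phi j).
Let Pstar := Pm kstar jstar.
Let M : R := (#|IPhi| * #|IPsi|)%:R.
Let L := ln (M / delta).
Let l k j s a := l1dist lam (Pm k j) Pstar s a.

Let M1 : 1 <= M.
Proof.
rewrite ler1n muln_gt0; apply/andP; split; apply/card_gt0P; first by exists jstar.
by exists kstar.
Qed.

Let K1 : 1 < M / delta.
Proof. by case/andP: delta01 => d0 d1; rewrite ltr_pdivlMr// mul1r (lt_le_trans d1 M1). Qed.

Let L0 : 0 < L. Proof. exact: ln_gt0. Qed.

Let K := expR (2 * L).

Let KE : K^-1 = (delta / M) ^+ 2.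
Proof.
have K0 : 0 < M / delta by rewrite (lt_trans _ K1).
by rewrite /K expRM_natl /L lnK ?posrE// -exprVn invf_div.
Qed.

Let F1 (m : IPsi * IPhi) (u : S * S) (a : A) : R :=
  root_ratio lam (mu kstar) (mu m.1) (phi jstar) (phi m.2) u a.
Let F2 (m : IPsi * IPhi) (u : S * S) (a : A) : R :=
  tilted_sqr lam (mu kstar) (mu m.1) (phi jstar) (phi m.2) rho pib u.1 a.

Let prodF (F : S * S -> A -> R) w := \prod_(i < n) F (Xs i w, Xs' i w) (Xa i w).

Let mprodF (F : S * S -> A -> R) : (forall a, measurable_fun setT (F^~ a)) ->
  measurable_fun setT (prodF F).
Proof.
move=> mF; apply: measurable_prod => i _.
apply: (measurable_fun_finite_arg (X := fun w => (Xs i w, Xs' i w))) => //.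
exact: measurable_fun_pair.
Qed.

Let tail (F : S * S -> A -> R) (b : S -> A -> R) :
  (forall a, measurable_fun setT (F^~ a)) -> (forall u a, 0 <= F u a) ->
  (forall a, bmeas (b^~ a)) ->
  (forall s a, \int[lam]_s' (F (s, s') a * Pstar s a s')%:E <= (b s a)%:E)%E ->
  rho_exp lam rho pib b <= 1 ->
  measurable [set w | K <= prodF F w] /\
  (Pr [set w | (K <= prodF F w)%R] <= ((delta / M) ^+ 2)%:E)%E.
Proof.
move=> mF F0 bb Fb b1; rewrite -KE; apply: markov_le1.
- exact: mprodF.
- by move=> w; exact: prodr_ge0.
- exact: expR_gt0.
- exact: (sample_prod_le1 (MM kstar jstar) mpib rho0 mrho rho1 mXs mXs' mXa sample_law mF F0 bb Fb b1).
Qed.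

Let EL := rho_expectation mpib rho0 mrho rho1.

Let tail1 m : measurable [set w | K <= prodF (F1 m) w] /\
  (Pr [set w | (K <= prodF (F1 m) w)%R] <= ((delta / M) ^+ 2)%:E)%E.
Proof.
apply: (tail (b := fun _ _ => 1)).
- exact: (measurable_root_ratio (MM _ _) (MM _ _)).
- by move=> u a; exact: root_ratio_ge0.
- by move=> a; exact: (alg_cst bmeas_algebra).
- by move=> s a; exact: (integral_root_ratio_le1 (MM _ _) (MM _ _)).
- by have /= -> := expect1 EL.
Qed.

Let tail2 m : measurable [set w | K <= prodF (F2 m) w] /\
  (Pr [set w | (K <= prodF (F2 m) w)%R] <= ((delta / M) ^+ 2)%:E)%E.
Proof.
have bt := tilted_sqr_bmeas (MM kstar jstar) (MM m.1 m.2) rho pib.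
apply: (tail (b := tilted_sqr lam (mu kstar) (mu m.1) (phi jstar) (phi m.2) rho pib)).
- by move=> a; have [mt _] := bt a; exact: (measurableT_comp mt).
- by move=> u a; exact: tilted_sqr_ge0.
- exact: bt.
- move=> s a; rewrite /F2 /=; under eq_integral do rewrite EFinM.
  rewrite ge0_integralZl_EFin ?tilted_sqr_ge0//.
  + by rewrite (lowrank_int1 (MM _ _)) mule1.
  + by move=> s' _; rewrite lee_fin (lowrank_ge0 (MM _ _)).
  + apply/measurable_EFinP; exact: (lowrank_density_measurable (MM _ _)).
- exact: (rho_exp_tilted_le1 (MM _ _) (MM _ _)).
Qed.

Let mstar := (kstar, jstar).

Let good1_star w : (forall i, 0 < Pstar (Xs i w) (Xa i w) (Xs' i w)) ->
  prodF (F1 mstar) w = 1.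
Proof.
move=> p0; apply: big1 => i _.
rewrite /F1 /root_ratio /= l1distxx expr0n mul0r expR0 mulr1 divff ?sqrtr1//.
exact: lt0r_neq0.
Qed.

Let good2_star w : prodF (F2 mstar) w = 1.
Proof.
apply: big1 => i _; rewrite /F2 /tilted_sqr /quarter_sqr /= l1distxx expr0n mul0r oppr0.
rewrite (_ : rho_exp _ _ _ _ = 0) ?mul0r ?expR0 ?mul1r//.
have /= <- := expect_cst EL 0; congr rho_exp; apply/funext => s; apply/funext => a.
by rewrite l1distxx expr0n mul0r.
Qed.

(* The true model is excluded from the union bound, which is what makes the threshold
   [2 L], without an additive constant, sufficient for every [delta < 1]. *)
Lemma likelihood_event : exists E : set Omega,
  [/\ measurable E, ((1 - delta)%:E <= Pr E)%E &
   forall w, E w -> [/\ forall i, 0 < Pstar (Xs i w) (Xa i w) (Xs' i w),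
     forall m, prodF (F1 m) w < K & forall m, prodF (F2 m) w < K]].
Proof.
pose Z i := [set w | Pstar (Xs i w) (Xa i w) (Xs' i w) = 0].
have mZ i : measurable (Z i).
  have m := @measurable_fun_finite_arg R _ (S * S)%type _ _ A
    (fun w => (Xs i w, Xs' i w)) (Xa i) (fun u a => Pstar u.1 a u.2)
    (measurable_fun_pair (mXs i) (mXs' i)) (mXa i)
    (fun a => lowrank_density_measurable_pair a (MM kstar jstar)).
  by rewrite -[Z i]setTI; exact: (m measurableT _ (measurable_set1 0)).
have PZ i : Pr (Z i) = 0%E.
  exact: (sample_density_eq0_null (MM kstar jstar) mpib rho0 mrho rho1 mXs mXs' mXa sample_law).
pose B m := [set w | K <= prodF (F1 m) w] `|` [set w | K <= prodF (F2 m) w].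
have mB m : measurable (B m).
  by apply: measurableU; [case: (tail1 m)|case: (tail2 m)].
have PB m : (Pr (B m) <= (2 * (delta / M) ^+ 2)%:E)%E.
  have [m1 t1] := tail1 m; have [m2 t2] := tail2 m.
  apply: le_trans (measureU2 _ m1 m2) _.
  by rewrite (_ : 2 * _ = (delta / M) ^+ 2 + (delta / M) ^+ 2) ?EFinD ?leeD//; ring.
pose UZ := \big[setU/set0]_(i < n) Z i.
pose UB := \big[setU/set0]_(m | m != mstar) B m.
have mUZ : measurable UZ by exact: bigsetU_measurable.
have mUB : measurable UB by exact: bigsetU_measurable.
have PUZ : (Pr UZ <= 0)%E.
  by apply: le_trans (measure_bigsetU_le _ _ _ mZ) _; rewrite big1 => [|i _]; [|exact: PZ].
case/andP: (delta01) => d0 d1.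
have PUB : (Pr UB <= delta%:E)%E.
  apply: le_trans (measure_bigsetU_le _ _ _ mB) _.
  apply: le_trans (lee_sum _ (fun m _ => PB m)) _.
  rewrite sumEFin lee_fin sumr_const cardC1 card_prod mulnC -[_ *+ _.-1]mulr_natr.
  have -> : (#|IPhi| * #|IPsi|).-1%:R = M - 1 :> R.
    by rewrite -subn1 natrB// -(ler1n R).
  have M0 : 0 < M by rewrite (lt_le_trans _ M1).
  rewrite expr_div_n mulrA mulrAC ler_pdivrMr ?exprn_gt0//.
  (* Here [x] is the number [M] of index pairs: [M - 1] pairs remain, each with two tails of size
     [(delta / M)^2]. The claim follows from [delta < 1] and [2 (x - 1) <= x^2]. *)
  suff aux (x : R) : 1 <= x -> 2 * delta ^+ 2 * (x - 1) <= delta * x ^+ 2 by exact: aux.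
  move=> x1; have h1 : 0 <= delta * (1 - delta) * (x - 1).
    by rewrite !mulr_ge0 ?subr_ge0// ltW.
  have h2 : 0 <= delta * (x - 2) ^+ 2 by rewrite mulr_ge0 ?sqr_ge0// ltW.
  have h3 : 0 <= delta * x ^+ 2 by rewrite mulr_ge0 ?sqr_ge0// ltW.
  nra.
exists (~` (UZ `|` UB)); split.
- by apply: measurableC; exact: measurableU.
- rewrite probability_setC; last exact: measurableU.
  rewrite EFinB leeB// (le_trans (measureU2 _ mUZ mUB))//.
  by rewrite -[leRHS]add0e leeD.
move=> w /not_orP[nZ nB].
have p0 i : 0 < Pstar (Xs i w) (Xa i w) (Xs' i w).
  rewrite lt_def (lowrank_ge0 (MM _ _)) andbT; apply/eqP => z; apply: nZ.
  by rewrite /UZ -bigcup_seq; exists i => //=; rewrite mem_index_enum.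
have K1' : 1 < K by rewrite /K -expR0 ltr_expR mulr_gt0.
have nBm m : m != mstar -> ~ B m w.
  move=> mm Bw; apply: nB; rewrite /UB -bigcup_seq_cond; exists m => //=.
  by rewrite mem_index_enum.
split=> // m; have [->|mm] := eqVneq m mstar.
- by rewrite good1_star.
- by rewrite ltNge; apply/negP => h; apply: (nBm m mm); left.
- by rewrite good2_star.
- by rewrite ltNge; apply/negP => h; apply: (nBm m mm); right.
Qed.

End MLEEvent.

(** * Deterministic error bounds on the event *)

Section ErrorBounds.
Set Implicit Arguments. Unset Strict Implicit.
Context {R : realType} {dS : measure_display} {S : measurableType dS} {A : finType}.
Variables (lam : {measure set S -> \bar R}) (d : nat).
Variables (mu mu' : S -> 'I_d -> R) (phi phi' : S -> A -> 'I_d -> R).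
Hypotheses (M : lowrank_model lam mu phi) (M' : lowrank_model lam mu' phi').
Let P : tdens := lowrank_density mu phi.
Let Q : tdens := lowrank_density mu' phi'.
Variables (n : nat) (s s' : 'I_n -> S) (a : 'I_n -> A) (L : R).

(** A likelihood at least that of the true model makes the root ratios multiply to at least one, so
    the exponential factors alone stay below the threshold: the sum of [l^2 / 8] is less than
    [2 L]. *)
Lemma mle_error_le :
  (forall i, 0 < P (s i) (a i) (s' i)) ->
  (\sum_(i < n) elog (P (s i) (a i) (s' i)) <= \sum_(i < n) elog (Q (s i) (a i) (s' i)))%E ->
  \prod_(i < n) root_ratio lam mu mu' phi phi' (s i, s' i) (a i) < expR (2 * L) ->
  \sum_(i < n) l1dist lam Q P (s i) (a i) ^+ 2 <= 16 * L.
Proof.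
move=> p0 mle; rewrite big_split /= prod_expR.
have Q0 i : 0 <= Q (s i) (a i) (s' i) by exact: (lowrank_ge0 M').
have ratio := elog_sum_le p0 Q0 mle.
move=> lt; have : expR (\sum_(i < n) l1dist lam Q P (s i) (a i) ^+ 2 / 8) < expR (2 * L).
  by apply: le_lt_trans lt; rewrite ler_peMl ?expR_ge0.
rewrite ltr_expR -mulr_suml; lra.
Qed.

Variables (rho : S -> R) (pib : S -> A -> R).
Hypotheses (mpib : markov_policy (fun _ => pib)) (rho0 : forall s, 0 <= rho s)
  (mrho : measurable_fun setT rho) (rho1 : (\int[lam]_s (rho s)%:E = 1)%E).

(** The logarithm of the hypothesis reads [n E l^2 / 8 - sum l^2 / 4 < 2 L]; multiply by 8. *)
Lemma population_error_le :
  \prod_(i < n) tilted_sqr lam mu mu' phi phi' rho pib (s i) (a i) < expR (2 * L) ->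
  n%:R * rho_exp lam rho pib (fun s a => l1dist lam Q P s a ^+ 2) <=
  16 * L + 2 * \sum_(i < n) l1dist lam Q P (s i) (a i) ^+ 2.
Proof.
rewrite big_split /= !prod_expR -expRD ltr_expR sumrN sumr_const card_ord -mulr_suml.
have -> : rho_exp lam rho pib (quarter_sqr lam mu mu' phi phi') =
    4^-1 * rho_exp lam rho pib (fun s a => l1dist lam Q P s a ^+ 2).
  have EL := rho_expectation mpib rho0 mrho rho1.
  have bl2 : sabmeas (fun u : S * A => l1dist lam Q P u.1 u.2 ^+ 2).
    by move=> b; apply: (alg_sqr bmeas_algebra); exact: l1dist_bmeas.
  have /= <- := expectZ EL 4^-1 bl2; congr rho_exp.
  by apply/funext => x; apply/funext => b; rewrite /quarter_sqr mulrC.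
rewrite -mulr_natl; set r := rho_exp _ _ _ _; set e := \sum_(i < n) _; lra.
Qed.

End ErrorBounds.

(** * Coordinate bounds and extended ratios *)

Section Norms.
Set Implicit Arguments. Unset Strict Implicit.
Context {R : realType}.

Lemma norm2_ge_coord (d : nat) (x : 'I_d -> R) i : `|x i| <= norm2 x.
Proof.
rewrite -sqrtr_sqr ler_wsqrtr// (bigD1 i)//= lerDl.
by apply: sumr_ge0 => j _; exact: sqr_ge0.
Qed.

(** A finite bound on the ratio also covers a zero denominator: the ratio would be [+oo] unless the
    numerator vanishes as well. *)
Lemma eratio_le_fine (C : \bar R) (x y : R) : (C < +oo)%E -> 0 <= y ->
  (eratio x y <= C)%E -> x <= fine C * y.
Proof.
move=> Cfin y0; rewrite /eratio; case: ifPn => [yp|].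
  by case: C Cfin => [c| |]//= _; rewrite lee_fin ler_pdivrMr.
rewrite -leNgt => yn; have -> : y = 0 by apply/eqP; rewrite eq_le yn y0.
case: eqP => [->|_]; first by rewrite mulr0.
by rewrite leye_eq => /eqP CE; rewrite CE in Cfin.
Qed.

Lemma eratio_ge0 (x y : R) : 0 <= x -> (0 <= eratio x y)%E.
Proof.
move=> x0; rewrite /eratio; case: ifPn => [yp|_]; first by rewrite lee_fin divr_ge0// ltW.
by case: ifP.
Qed.

End Norms.

(** * The regret bound for pessimistic policy optimisation *)

Theorem theorem2 (R : realType) :
  exists c1 : R, 0 < c1 /\
  forall (dS : measure_display) (S : measurableType dS)
    (lam : {measure set S -> \bar R})            (* base measure "ds" *)
    (A : finType) (H : nat) (r : S -> A -> R) (d0 : probability S R)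
    (d : nat)
    (IPsi : finType) (mu : IPsi -> S -> 'I_d -> R)          (* the class Psi *)
    (IPhi : finType) (phi : IPhi -> S -> A -> 'I_d -> R)    (* the class Phi *)
    (kstar : IPsi) (jstar : IPhi)
    (pib : S -> A -> R) (rho : S -> R)
    (pistar : nat -> S -> A -> R)
    (delta : R) (n : nat)
    (dO : measure_display) (Omega : measurableType dO) (Pr : probability Omega R)
    (Xs : 'I_n -> Omega -> S) (Xa : 'I_n -> Omega -> A) (Xs' : 'I_n -> Omega -> S),
  (* reward in [0,1] *)
  (forall s a, 0 <= r s a <= 1) ->
  (forall a, measurable_fun setT (fun s => r s a)) ->
  (* finite classes (index maps injective, so |Psi| = #|IPsi|, |Phi| = #|IPhi|) *)
  injective mu -> injective phi ->
  (forall k i, measurable_fun setT (fun s => mu k s i)) ->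
  (forall j a i, measurable_fun setT (fun s => phi j s a i)) ->
  (forall j s a, norm2 (phi j s a) <= 1) ->
  (forall k, (\int[lam]_s (norm2 (mu k s))%:E < +oo)%E) ->
  (* every element mu^T phi of the model class M is a transition density *)
  (forall k j s a s', 0 <= dotv (mu k s') (phi j s a)) ->
  (forall k j s a, (\int[lam]_s' (dotv (mu k s') (phi j s a))%:E = 1)%E) ->
  (* behaviour policy and its stationary distribution rho *)
  (forall s a, 0 <= pib s a) -> (forall s, \sum_(a : A) pib s a = 1) ->
  (forall a, measurable_fun setT (fun s => pib s a)) ->
  (forall s, 0 <= rho s) -> measurable_fun setT rho ->
  (\int[lam]_s (rho s)%:E = 1)%E ->
  (forall s, rho s = Rintegral lam setT (fun s' =>
        rho s' * \sum_(a' : A) pib s' a' * dotv (mu kstar s) (phi jstar s' a'))) ->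
  (* comparator *)
  markov_policy pistar ->
  (Cbar (Sigma_pi lam d0 H (phi jstar) (fun s a s' => dotv (mu kstar s') (phi jstar s a)) pistar)
        (Sigma_rho lam rho pib (phi jstar)) < +oo)%E ->
  (Cd0 (fun m : IPsi * IPhi => fun s a s' => dotv (mu m.1 s') (phi m.2 s a)) lam d0 rho pib
       (fun s a s' => dotv (mu kstar s') (phi jstar s a)) < +oo)%E ->
  0 < pib_min pib ->
  (* data: n i.i.d. samples (s_i,a_i,s'_i), (s_i,a_i) ~ rho, s'_i ~ P*(.|s_i,a_i) *)
  0 < delta < 1 -> (0 < n)%N ->
  (forall i, measurable_fun setT (Xs i)) -> (forall i, measurable_fun setT (Xs' i)) ->
  (forall i a, measurable [set w | Xa i w = a]) ->
  (forall (B1 B2 : 'I_n -> set S) (al : 'I_n -> A),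
     (forall i, measurable (B1 i)) -> (forall i, measurable (B2 i)) ->
     Pr (\bigcap_(i in [set: 'I_n])
           [set w | B1 i (Xs i w) /\ Xa i w = al i /\ B2 i (Xs' i w)])
     = (\prod_(i < n) Rintegral lam (B1 i) (fun s => rho s * pib s (al i) *
            Rintegral lam (B2 i) (fun s' => dotv (mu kstar s') (phi jstar s (al i)))))%:E) ->
  let Pm := fun (k : IPsi) (j : IPhi) => fun s a s' => dotv (mu k s') (phi j s a) in
  let Pstar := Pm kstar jstar in
  let xi := c1 * ln ((#|IPhi| * #|IPsi|)%:R / delta) / n%:R in
  let loglik := fun (w : Omega) (k : IPsi) (j : IPhi) =>
      (((n%:R)^-1)%:E * \sum_(i < n)
        (elog (dotv (mu k (Xs' i w)) (phi j (Xs i w) (Xa i w)))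
         - elog (Rintegral lam setT (fun s'' => dotv (mu k s'') (phi j (Xs i w) (Xa i w)))))%E)%E in
  let inMD := fun (w : Omega) (kh : IPsi) (jh : IPhi) (k : IPsi) (j : IPhi) =>
      (n%:R)^-1 * \sum_(i < n) l1dist lam (Pm k j) (Pm kh jh) (Xs i w) (Xa i w) ^+ 2 <= xi in
  let minV := fun (w : Omega) (kh : IPsi) (jh : IPhi) (pi : nat -> S -> A -> R) =>
      inf [set x | exists (k : IPsi) (j : IPhi),
                     inMD w kh jh k j /\ x = value lam d0 H r (Pm k j) pi] in
  let bound := Num.sqrt xi * Num.sqrt (#|A|%:R) *
      (H%:R * Num.sqrt (fine (Cd0 (fun m : IPsi * IPhi => Pm m.1 m.2) lam d0 rho pib Pstar))
       + H%:R ^+ 2 * Num.sqrt (fine (Cbar (Sigma_pi lam d0 H (phi jstar) Pstar pistar)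
                                          (Sigma_rho lam rho pib (phi jstar)))
                               * (\rank (Sigma_rho lam rho pib (phi jstar)))%:R
                               / pib_min pib)) in
  exists E : set Omega, [/\ measurable E, ((1 - delta)%:E <= Pr E)%E &
    forall w, E w ->
    forall (kh : IPsi) (jh : IPhi),
      (forall k j, (loglik w k j <= loglik w kh jh)%E) ->      (* (mu^,phi^) is an MLE *)
    forall pihat, markov_policy pihat ->
      (forall pi, markov_policy pi -> minV w kh jh pi <= minV w kh jh pihat) -> (* CPPO *)
      value lam d0 H r Pstar pistar - value lam d0 H r Pstar pihat <= bound].
Proof.
(* The constant solves [16 + 2 (3 / 2 c + 3 * 16) = 4 c]: population error from empirical error on
   the left, the target [4 xi] in units of [L / n] on the right. *)
exists 112; split => // dS S lam A H r d0 d IPsi mu IPhi phi kstar jstar pib rho pistar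
  delta n dO Omega Pr Xs Xa Xs' r01 mr _ _ mmu mphi phi1 imu dens0 dens1 pib0 pib1 mpib
  rho0 mrho rho1 rho_stat mpistar Cbar_fin Cd0_fin pmin0 delta01 n0 mXs mXs' mXa law
  Pm Pstar xi loglik inMD minV bound.
have MM k j : lowrank_model lam (mu k) (phi j).
  split=> //.
  - move=> i; apply/integrableP; split; first exact/measurable_EFinP.
    apply: le_lt_trans (imu k); apply: ge0_le_integral => //.
    + by do 2 apply: measurableT_comp => //.
    + apply/measurable_EFinP; apply: measurable_fun_sqrtr => [s|].
        by apply: sumr_ge0 => ? _; exact: sqr_ge0.
      by apply: measurable_sum => i'; exact: measurable_funX.
    + by move=> s _; rewrite /= lee_fin; exact: norm2_ge_coord.
  - move=> a i; split => //; exists 1 => s.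
    exact: le_trans (norm2_ge_coord (phi j s a) i) (phi1 j s a).
have mpibp : markov_policy (fun _ : nat => pib) by split.
have [E [mE PE Egood]] := likelihood_event MM mpibp rho0 mrho rho1 mXs mXs' mXa law delta01.
exists E; split=> // w Ew kh jh mle pihat mpihat cppo.
have {Egood} [p0 good1 good2] := Egood w Ew.
pose L := ln ((#|IPhi| * #|IPsi|)%:R / delta); have xiE : xi = 112 * L / n%:R by [].
pose l k j s a := l1dist lam (Pm k j) Pstar s a.
have nR : 0 < n%:R :> R by rewrite ltr0n.
have mean_le (f : 'I_n -> R) (c : R) :
    (n%:R^-1 * \sum_(i < n) f i <= c / n%:R) = (\sum_(i < n) f i <= c).
  by rewrite mulrC ler_pM2r// invr_gt0.
have hat_err : \sum_(i < n) l kh jh (Xs i w) (Xa i w) ^+ 2 <= 16 * L.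
  apply: (mle_error_le (s := Xs^~ w) (s' := Xs'^~ w) (a := Xa^~ w) (L := L)
    (MM kh jh) p0 _ (good1 (kh, jh))).
  (* Each member of the class integrates to one, so the normalising logarithm is [ln 1 = 0]. *)
  have llE k j : loglik w k j = ((n%:R^-1)%:E *
      \sum_(i < n) elog (dotv (mu k (Xs' i w)) (phi j (Xs i w) (Xa i w))))%E.
    congr (_ * _)%E; apply: eq_bigr => i _.
    rewrite /Rintegral dens1 /= {2}/elog ltr01 ln1 sube0//.
  by have := mle kstar jstar; rewrite !llE lee_pmul2l// lte_fin invr_gt0.
have L0 : 0 <= L.
  rewrite -(pmulr_rge0 _ (_ : 0 < 16))//; apply: le_trans hat_err.
  by apply: sumr_ge0 => i _; exact: sqr_ge0.
have xi0 : 0 <= xi by rewrite xiE divr_ge0// mulr_ge0.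
have star_in : inMD w kh jh kstar jstar.
  rewrite /inMD xiE mean_le; apply: le_trans (_ : 16 * L <= _); last by lra.
  apply: le_trans hat_err; apply: ler_sum => i _.
  by rewrite -l1distC.
have version_err k j : inMD w kh jh k j ->
    rho_exp lam rho pib (fun s a => l k j s a ^+ 2) <= 4 * xi.
  rewrite /inMD xiE mean_le => Dkj.
  have := population_error_le (s := Xs^~ w) (a := Xa^~ w) (L := L) (MM kstar jstar) (MM k j) mpibp rho0 mrho rho1 (good2 (k, j)).
  rewrite -/(l k j) -[lowrank_density _ _]/(Pm k j) => pop.
  (* Weighted form of [(y + z)^2], from [(y - 2 z)^2 >= 0]. The weight of [y^2] has to be below 2,
     since it is doubled in [pop] and compared with [4 xi]; equal weights would leave no room. *)
  have emp : \sum_(i < n) l k j (Xs i w) (Xa i w) ^+ 2 <=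
      \sum_(i < n) (3 / 2 * l1dist lam (Pm k j) (Pm kh jh) (Xs i w) (Xa i w) ^+ 2 +
                    3 * l kh jh (Xs i w) (Xa i w) ^+ 2).
    apply: ler_sum => i _.
    have tri := l1dist_triangle (Xs i w) (Xa i w) (MM k j) (MM kh jh) (MM kstar jstar).
    have l0 : 0 <= l k j (Xs i w) (Xa i w) by exact: Rintegral_ge0.
    move: tri l0; rewrite /l -/(Pm k j).
    set x := l1dist _ _ Pstar _ _; set y := l1dist _ _ _ _ _; set z := l1dist _ _ _ _ _.
    move=> tri x0; have := sqr_ge0 (y - 2 * z); nra.
  rewrite big_split /= -!mulr_sumr in emp.
  rewrite mulrA ler_pdivlMr// mulrC; apply: le_trans pop _; lra.
have regret k j : inMD w kh jh k j ->
    value lam d0 H r Pstar pistar - value lam d0 H r (Pm k j) pistar <= bound.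
  move=> /version_err lxi.
  have EL := rho_expectation mpibp rho0 mrho rho1.
  have bl2 k' j' : sabmeas (fun u : S * A => l k' j' u.1 u.2 ^+ 2).
    by move=> b; apply: (alg_sqr bmeas_algebra); exact: l1dist_bmeas.
  have l20 k' j' : 0 <= rho_exp lam rho pib (fun s a => l k' j' s a ^+ 2).
    by apply: (expect_ge0 EL (bl2 k' j')) => u; exact: sqr_ge0.
  have feat_bmeas i : sabmeas (fun u : S * A => phi jstar u.1 u.2 i).
    by move=> b; exact: (lowrank_bmeas (MM kstar jstar)).
  (* [d0] has mass one, so there is a state, and action probabilities there sum to one. *)
  have A0 : (0 < #|A|)%N.
    rewrite lt0n; apply/eqP => A0.
    have S0 : [set: S] = set0.
      apply/seteqP; split=> // s _; have := pib1 s.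
      rewrite big_pred0 => [|b]; last by have := card0_eq A0 b; rewrite inE.
      by move/eqP; rewrite eq_sym oner_eq0.
    have := probability_setT d0; rewrite S0 measure0 => /eqP.
    by rewrite eq_sym onee_eq0.
  apply: (@regret_le _ _ _ _ lam d0 d (mu kstar) (mu k) (phi jstar) (phi j)
    (MM _ _) (MM _ _) (l1dist_bmeas (MM _ _) (MM _ _)) _ mpistar pib rho (pib_min pib)) => //.
  - move=> s a; apply: ge_inf; last by exists s, a.
    by exists 0 => _ [s' [a' ->]].
  - apply: fine_ge0; apply: le_trans (ereal_sup_ubound _); last first.
      by exists (kstar, jstar).
    apply: eratio_ge0; apply: Rintegral_ge0 => s _; rewrite mulr_ge0 ?invr_ge0//.
    by apply: sumr_ge0 => a _; exact: sqr_ge0.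
  - apply: fine_ge0; apply: le_trans (ereal_sup_ubound _); last by exists 0.
    by apply: eratio_ge0; rewrite /quadf mulmx0 mxE.
  - by apply: (eratio_le_fine Cd0_fin (l20 k j)); apply: ereal_sup_ubound; exists (k, j).
  - move=> x; apply: (eratio_le_fine Cbar_fin (quadf_moment_ge0 feat_bmeas x EL)).
    by apply: ereal_sup_ubound; exists x.
(* Both infima are genuine: the true model makes the sets nonempty, and values are nonnegative.
   Membership of the true model also bounds the pessimistic value of [pihat] by its true value. *)
have : value lam d0 H r Pstar pistar - bound <= value lam d0 H r Pstar pihat.
  apply: (@le_trans _ _ (minV w kh jh pistar)).
    apply: lb_le_inf; first by exists (value lam d0 H r Pstar pistar), kstar, jstar.
    by move=> _ [k [j [kj ->]]]; have := regret k j kj; lra.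
  apply: le_trans (cppo _ mpistar) _; apply: ge_inf; last by exists kstar, jstar.
  by exists 0 => _ [k [j [_ ->]]]; exact: (value_ge0 d0 (MM k j) mpihat).
lra.
Qed.
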